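(* Let $N$ be a unitarily invariant norm on $M_n(\mathbb{C})$, let $P\in\mathcal{G}l(n)^+$ and $t\in(0,1)$. Then the set $$\mathcal{M}_t(I,P)=\{W\in\mathcal{G}l(n)^+: d_N(I,W)=t\,d_N(I,P)\ \text{ and }\ d_N(W,P)=(1-t)\,d_N(I,P)\}$$ is geodesically convex.
   Context: $\mathcal{G}l(n)^+$ is the cone of $n\times n$ positive (definite) invertible complex matrices. $d_N(A,B)$ is the infimum of the lengths $L(\alpha)=\int_0^1N\big(\alpha(t)^{-1/2}\dot\alpha(t)\alpha(t)^{-1/2}\big)dt$ of piecewise smooth curves $\alpha:[0,1]\to\mathcal{G}l(n)^+$ joining $A$ with $B$; it is given by $d_N(A,B)=N\big(\log(A^{-1/2}BA^{-1/2})\big)$. The geodesic joining $A,B\in\mathcal{G}l(n)^+$ is $\gamma(s)=A^{1/2}(A^{-1/2}BA^{-1/2})^sA^{1/2}$, $s\in[0,1]$. A set $\mathcal M\subseteq\mathcal{G}l(n)^+$ is geodesically convex if for all $W_0,W_1\in\mathcal M$ the geodesic joining them is contained in $\mathcal M$. *)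

(* Defs.v *)
From HB Require Import structures.
From mathcomp Require Import all_boot all_order all_algebra.
From mathcomp Require Import complex.
From mathcomp Require Import all_classical all_reals all_analysis.

Set Implicit Arguments.
Unset Strict Implicit.
Unset Printing Implicit Defensive.

Import Order.TTheory GRing.Theory Num.Theory.
Import numFieldNormedType.Exports.

Local Open Scope classical_set_scope.
Local Open Scope ring_scope.
Local Open Scope complex_scope.
Local Open Scope sesquilinear_scope.

Section Definitions.
Context {R : realType} {n : nat}.
Local Notation C := R[i].
Local Notation M := 'M[C]_n.

Record unitarily_invariant_norm (N : M -> R) : Prop := {
  uinorm_triangle : forall A B : M, N (A + B) <= N A + N B;
  uinorm_scale : forall (a : C) (A : M), N (a *: A) = Normc.normc a * N A;
  uinorm_eq0 : forall A : M, N A = 0 -> A = 0;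
  uinorm_unitary : forall A U V : M,
    U \is unitarymx -> V \is unitarymx -> N (U *m A *m V) = N A }.

(* The order of R[i] is partial: 0 < z also says that z is real. *)
Definition posdef : set M := [set A | A \is hermsymmx /\
  forall v : 'rV[C]_n, v != 0 -> 0 < (v *m A *m v^t*) 0 0].

(* A ^ s by the functional calculus. Only meant for A positive definite: then
   A = invmx Q *m diag_mx d *m Q with Q := spectralmx A unitary and
   d := spectral_diag A a row of positive reals, and the result does not depend
   on the chosen diagonalization. *)
Definition mxpowR (A : M) (s : R) : M :=
  invmx (spectralmx A)
  *m diag_mx (map_mx (fun z : C => (complex.Re z `^ s)%:C) (spectral_diag A))
  *m spectralmx A.

Definition smooth (f : R -> R) : Prop :=
  forall (k : nat) (x : R), derivable (derive1n k f) x 1.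

Definition mxsmooth (a : R -> M) : Prop := forall i j,
  smooth (fun t => complex.Re (a t i j)) /\
  smooth (fun t => complex.Im (a t i j)).

(* Smoothness on a closed piece [c, d] means that a coincides there with some
   smooth curve defined on the whole line. Consecutive pieces share their
   endpoint, so that a is continuous on [0, 1]. *)
Definition piecewise_smooth (a : R -> M) : Prop :=
  exists2 s : seq R, itv_partition 0 1 s &
    forall i, (i < size s)%N -> exists2 b : R -> M, mxsmooth b &
      {in `[nth 0 (0 :: s) i, nth 0 s i], a =1 b}.

(* Meaningful wherever the entries of a are derivable; along a piecewise smooth
   curve this fails at finitely many points only, which the integral in
   curve_length ignores. *)
Definition velocity (a : R -> M) (t : R) : M := \matrix_(i, j)
  (derive1 (fun u => complex.Re (a u i j)) t +i*
   derive1 (fun u => complex.Im (a u i j)) t).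

Definition joining_curve (A B : M) (a : R -> M) : Prop :=
  [/\ piecewise_smooth a, {in `[0, 1], forall t, posdef (a t)},
      a 0 = A & a 1 = B].

Definition curve_length (N : M -> R) (a : R -> M) : R :=
  Rintegral lebesgue_measure `[0, 1] (fun t =>
    N (mxpowR (a t) (- 2^-1) *m velocity a t *m mxpowR (a t) (- 2^-1))).

Definition dist (N : M -> R) (A B : M) : R :=
  inf [set curve_length N a | a in [set a | joining_curve A B a]].

Definition geodesic (A B : M) (s : R) : M :=
  mxpowR A 2^-1
  *m mxpowR (mxpowR A (- 2^-1) *m B *m mxpowR A (- 2^-1)) s
  *m mxpowR A 2^-1.

Definition geodesically_convex (S : set M) : Prop :=
  S `<=` posdef /\
  forall W0 W1, S W0 -> S W1 -> {in `[0, 1], forall s, S (geodesic W0 W1 s)}.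

Definition midset (N : M -> R) (t : R) (A B : M) : set M :=
  [set W | [/\ posdef W, dist N A W = t * dist N A B
             & dist N W B = (1 - t) * dist N A B]].

End Definitions.

(* Main.v *)
(* Let q(A, B) = N(A^(-1/2) (B - A) B^(-1/2)). Along a fine subdivision of a curve
   the sum of the q(x_k, x_(k+1)) approximates the length of the curve from below,
   and a polygon through a chain whose steps are small in the Loewner order has
   length close to the sum of its q's. Hence a map that multiplies q by at most c
   multiplies the distance by at most c. Congruences preserve q, and the square root
   halves it by the Corach-Porta-Recht inequality
   2 N(W) <= N(S W T^-1 + S^-1 W T); no formula for the distance is needed.
   With the triangle inequality this makes d(Z, C^s) and d(C^s, Z) midpoint convex
   in s, hence convex by continuity, and a congruence carries any geodesic to some
   s |-> C^s. So d(I, W_s) <= t d(I, P) and d(W_s, P) <= (1 - t) d(I, P) along a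
   geodesic W_s of the set, and the triangle inequality turns both into equalities. *)

Require Import Defs.
From mathcomp Require Import all_boot all_order all_algebra.
From mathcomp Require Import complex.
From mathcomp Require Import all_classical all_reals all_analysis.
From mathcomp Require Import measurable_realfun ring lra.

Set Implicit Arguments.
Unset Strict Implicit.
Unset Printing Implicit Defensive.

Import Order.TTheory GRing.Theory Num.Theory.
Import numFieldNormedType.Exports.

Local Open Scope classical_set_scope.
Local Open Scope ring_scope.
Local Open Scope complex_scope.
Local Open Scope sesquilinear_scope.

(** * Hermitian and positive definite matrices *)

Section Hermitian.
Context {R : realType} {n : nat}.
Local Notation C := R[i].
Local Notation M := 'M[C]_n.
Implicit Types (A B U X : M) (v : 'rV[C]_n) (d : 'rV[R]_n).

(** Whitening q at both endpoints, and not at A alone, is dictated by powers: in eigenbases of A and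
    B, q(A^s, B^s) is the norm of a fixed matrix multiplied entrywise by 2 sinh(s (b_j - a_i) / 2),
    where a_i and b_j are the logarithms of the eigenvalues. Since sinh 2z = 2 sinh z cosh z, going
    from s = 1 to s = 1/2 removes a factor 2 cosh, and the Corach-Porta-Recht inequality says that
    the multiplier cosh never decreases N. Chains replace curves because a chain is mapped point by
    point, so the square root never has to be differentiated along a curve. In return, consecutive
    points must be comparable in the Loewner order up to a factor 1 - th, a relation that
    congruences preserve, and square roots too, by operator monotonicity. Each passage between
    curves and chains costs a factor 1 - th, which disappears as th tends to 0. *)

Definition qform A v : R := complex.Re ((v *m A *m v^t*) 0 0).
Definition loewner A B := forall v, qform A v <= qform B v.
Definition rdiag d : M := diag_mx (map_mx (real_complex R) d).

Lemma adjM m p k (A : 'M[C]_(m, p)) (B : 'M[C]_(p, k)) :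
  (A *m B)^t* = B^t* *m A^t*.
Proof. by rewrite trmx_mul map_mxM. Qed.

Lemma adjD m p (A B : 'M[C]_(m, p)) : (A + B)^t* = A^t* + B^t*.
Proof. by rewrite linearD map_mxD. Qed.

Lemma adjB m p (A B : 'M[C]_(m, p)) : (A - B)^t* = A^t* - B^t*.
Proof. by rewrite linearB map_mxB. Qed.

Lemma adjZ m p a (A : 'M[C]_(m, p)) : (a *: A)^t* = a^* *: A^t*.
Proof. by rewrite linearZ /= map_mxZ. Qed.

Lemma adj1 : (1%:M : M)^t* = 1%:M.
Proof. by rewrite trmx1 map_mx1. Qed.

Lemma adjE m p (A : 'M[C]_(m, p)) i j : A^t* i j = conjc (A j i).
Proof. by rewrite !mxE. Qed.

Lemma rdiag_adj d : (rdiag d)^t* = rdiag d.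
Proof.
rewrite /rdiag tr_diag_mx map_diag_mx; congr diag_mx.
by apply/matrixP => i j; rewrite !mxE; exact: conjc_real.
Qed.

Lemma rdiagM d d' : rdiag d *m rdiag d' = rdiag (\row_i (d 0 i * d' 0 i)).
Proof.
rewrite /rdiag mul_mx_diag; apply/matrixP => i j; rewrite !mxE.
by case: eqVneq => [->|_]; rewrite ?mulr1n ?mulr0n ?mul0r// rmorphM.
Qed.

Lemma rdiag1 : rdiag (const_mx 1) = 1%:M.
Proof.
by rewrite /rdiag map_const_mx rmorph1 diag_const_mx.
Qed.

Lemma hermP A : reflect (A^t* = A) (A \is hermsymmx).
Proof.
by apply: (iffP (is_hermitianmxP _ _ _)); rewrite expr0 scale1r; exact: esym.
Qed.

Lemma qformD A B v : qform (A + B) v = qform A v + qform B v.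
Proof. by rewrite /qform mulmxDr mulmxDl !mxE raddfD. Qed.

Lemma qformB A B v : qform (A - B) v = qform A v - qform B v.
Proof. by rewrite /qform mulmxBr mulmxBl !mxE raddfB. Qed.

Lemma qformZ a A v : qform (a%:C *: A) v = a * qform A v.
Proof.
rewrite /qform -scalemxAr -scalemxAl !mxE.
by case: (X in _ * X) => x y /=; rewrite mul0r subr0.
Qed.

Lemma qform_conj A X v : qform (X *m A *m X^t*) v = qform A (v *m X).
Proof. by rewrite /qform adjM !mulmxA. Qed.

Lemma qform_rdiag d v :
  qform (rdiag d) v = \sum_i d 0 i * Normc.normc (v 0 i) ^+ 2.
Proof.
rewrite /qform mul_mx_diag mxE raddf_sum; apply: eq_bigr => i _.
rewrite !mxE; case: (v 0 i) => x y /=.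
rewrite sqr_sqrtr ?addr_ge0 ?sqr_ge0//; ring.
Qed.

Lemma herm_qform A v : A^t* = A -> (v *m A *m v^t*) 0 0 = (qform A v)%:C.
Proof.
move=> hA; have h : (v *m A *m v^t*)^t* = v *m A *m v^t* by rewrite !adjM trmxCK hA mulmxA.
have : conjc ((v *m A *m v^t*) 0 0) = (v *m A *m v^t*) 0 0 by rewrite -adjE h.
rewrite /qform; case: (_ 0 0) => x y [] /eqP; rewrite eqNr => /eqP ->.
by rewrite complexr0.
Qed.

Lemma posdefP A :
  posdef A <-> A^t* = A /\ forall v, v != 0 -> 0 < qform A v.
Proof.
split=> [[/hermP hA pA]|[hA pA]]; split=> //.
- by move=> v /pA; rewrite ltcE => /andP[].
- exact/hermP.
- by move=> v /pA; rewrite herm_qform// ltcR.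
Qed.

Lemma posdef_rdiag d : (forall i, 0 < d 0 i) -> posdef (rdiag d).
Proof.
move=> d0; apply/posdefP; split=> [|v v0]; first exact: rdiag_adj.
rewrite qform_rdiag lt_neqAle; apply/andP; split; last first.
  by apply: sumr_ge0 => i _; rewrite mulr_ge0 ?sqr_ge0// ltW.
apply: contra v0 => /eqP/esym/eqP.
rewrite psumr_eq0 => [/allP h|i _]; last by rewrite mulr_ge0 ?sqr_ge0// ltW.
apply/eqP/rowP => i; rewrite mxE.
have /= := h i (mem_index_enum _); rewrite mulf_eq0 (gt_eqF (d0 i)) /=.
by rewrite expf_eq0 /= => /eqP/Normc.eq0_normc.
Qed.

Lemma posdef_conj A X : X \in unitmx -> posdef A -> posdef (X *m A *m X^t*).
Proof.
move=> uX /posdefP[hA pA]; apply/posdefP; split.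
  by rewrite !adjM trmxCK hA mulmxA.
move=> v v0; rewrite qform_conj; apply: pA.
by apply: contra v0 => /eqP h; rewrite -(mulmxK uX v) h mul0mx.
Qed.

Lemma adj_unit X : X \in unitmx -> X^t* \in unitmx.
Proof.
move=> uX; have := adjM (invmx X) X; rewrite mulVmx// adj1 => /esym/mulmx1_unit[h _].
exact: h.
Qed.

(** [U] is the very eigenbasis from which [mxpowR] is built, so one decomposition diagonalizes all
    powers at once. *)
Lemma herm_spectral A : A^t* = A -> exists U d,
  [/\ U \is unitarymx, A = U^t* *m rdiag d *m U &
    forall s, mxpowR A s = U^t* *m rdiag (map_mx (fun x : R => x `^ s) d) *m U].
Proof.
move=> /hermP hA; have uU := spectral_unitarymx A.
pose d := map_mx (@complex.Re R) (spectral_diag A).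
have dE : spectral_diag A = map_mx (real_complex R) d.
  apply/rowP => i; have /mxOverP/(_ 0 i) := hermitian_spectral_diag_real hA.
  by move=> /RRe_real e; rewrite !mxE e.
exists (spectralmx A), d; split; first exact: uU.
  have := orthomx_spectralP (hermitian_normalmx hA).
  by rewrite (invmx_unitary uU) dE.
move=> s; rewrite /mxpowR (invmx_unitary uU).
suff -> : map_mx (fun z : C => (complex.Re z `^ s)%:C) (spectral_diag A) =
    map_mx (real_complex R) (map_mx (fun x : R => x `^ s) d) by [].
by apply/rowP => i; rewrite !mxE.
Qed.

Lemma mulmx_unitary_neq0 U v : U \is unitarymx -> v != 0 -> v *m U != 0.
Proof.
move=> /unitarymxP UU; apply: contra => /eqP h.
by rewrite -[v]mulmx1 -UU mulmxA h mul0mx.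
Qed.

Lemma qform_unitary U A v : U \is unitarymx ->
  qform (U^t* *m A *m U) (v *m U) = qform A v.
Proof.
move=> /unitarymxP UU; rewrite -[X in _ *m X](trmxCK U) qform_conj.
by rewrite -mulmxA UU mulmx1.
Qed.

Lemma qform_rdiag_delta d i : qform (rdiag d) (delta_mx 0 i) = d 0 i.
Proof.
have e j : (delta_mx 0 i : 'rV[C]_n) 0 j = (j == i)%:R by rewrite mxE eqxx.
rewrite qform_rdiag (bigD1 i)//= big1 => [|j ji]; rewrite e.
  by rewrite eqxx Normc.normc1 expr1n mulr1 addr0.
by rewrite (negbTE ji) Normc.normc0 expr0n mulr0.
Qed.

Lemma delta_mx_neq0 (i : 'I_n) : delta_mx 0 i != 0 :> 'rV[C]_n.
Proof.
apply/eqP => /matrixP/(_ 0 i); rewrite !mxE !eqxx /= => /eqP.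
by rewrite oner_eq0.
Qed.

Lemma unitary_rdiag1 U : U \is unitarymx -> U^t* *m rdiag (const_mx 1) *m U = 1%:M.
Proof. by move=> /unitarymxP/mulmx1C UU; rewrite rdiag1 mulmx1. Qed.

Lemma loewner_unitary U d (e : 'rV[R]_n) (c : R) : U \is unitarymx ->
  (forall i, c * d 0 i <= e 0 i) ->
  loewner (c%:C *: (U^t* *m rdiag d *m U)) (U^t* *m rdiag e *m U).
Proof.
move=> uU de v; have /unitarymxP/mulmx1C UU := uU.
have -> : v = (v *m U^t*) *m U by rewrite -mulmxA UU mulmx1.
rewrite qformZ !(qform_unitary _ _ uU) !qform_rdiag mulr_sumr.
by apply: ler_sum => i _; rewrite mulrA ler_wpM2r ?sqr_ge0.
Qed.

Lemma posdef_spectral A : posdef A -> exists U d,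
  [/\ U \is unitarymx, forall i, 0 < d 0 i, A = U^t* *m rdiag d *m U &
    forall s, mxpowR A s = U^t* *m rdiag (map_mx (fun x : R => x `^ s) d) *m U].
Proof.
move=> /posdefP[/herm_spectral[U [d [uU AE pE]]] pA]; exists U, d; split=> // i.
rewrite -(qform_rdiag_delta d i) -(qform_unitary _ _ uU) -AE pA//.
exact/mulmx_unitary_neq0/delta_mx_neq0.
Qed.
End Hermitian.

(** * Real powers of positive definite matrices and operator monotonicity of the square root *)

Section Powers.
Context {R : realType} {n : nat}.
Local Notation C := R[i].
Local Notation M := 'M[C]_n.
Implicit Types (A B U X Y : M) (v : 'rV[C]_n) (d : 'rV[R]_n).

Lemma posdef_unit A : posdef A -> A \in unitmx.
Proof.
move=> /posdef_spectral[U [d [uU d0 -> _]]].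
rewrite !unitmx_mul (unitarymx_unit uU) unitarymx_unit ?trmxC_unitary// andbT /=.
rewrite unitmxE /rdiag det_diag unitfE; apply/prodf_neq0 => i _.
by rewrite mxE; apply/negP => /eqP [] /eqP; rewrite gt_eqF.
Qed.

Lemma posdef_adj A : posdef A -> A^t* = A.
Proof. by case/posdefP. Qed.

Lemma posdef_unitary_conj U A : U \is unitarymx -> posdef A ->
  posdef (U^t* *m A *m U).
Proof.
move=> uU pA; rewrite -[X in _ *m X](trmxCK U); apply: posdef_conj => //.
by rewrite unitarymx_unit ?trmxC_unitary.
Qed.

Lemma posdef1 : @posdef R n 1%:M.
Proof. by rewrite -rdiag1; apply: posdef_rdiag => i; rewrite mxE. Qed.

Lemma mxpowR_posdef A s : posdef A -> posdef (mxpowR A s).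
Proof.
move=> /posdef_spectral[U [d [uU d0 _ ->]]].
by apply: posdef_unitary_conj => //; apply: posdef_rdiag => i; rewrite mxE powR_gt0.
Qed.

Lemma mxpowRD A s t : posdef A -> mxpowR A s *m mxpowR A t = mxpowR A (s + t).
Proof.
move=> /posdef_spectral[U [d [/unitarymxP UU d0 _ pE]]]; rewrite !pE.
rewrite -!mulmxA (mulmxA U) UU mul1mx (mulmxA (rdiag _) (rdiag _)) rdiagM.
congr (_ *m (rdiag _ *m _)); apply/rowP => i; rewrite !mxE powRD//.
by apply/implyP => _; rewrite gt_eqF.
Qed.

Lemma mxpowR0 A : posdef A -> mxpowR A 0 = 1%:M.
Proof.
move=> /posdef_spectral[U [d [uU d0 _ ->]]].
have -> : map_mx (fun x : R => x `^ 0) d = const_mx 1.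
  by apply/rowP => i; rewrite !mxE powRr0.
rewrite rdiag1 mulmx1; have := uU; rewrite -trmxC_unitary => /unitarymxP.
by rewrite trmxCK.
Qed.

Lemma mxpowR1 A : posdef A -> mxpowR A 1 = A.
Proof.
move=> /posdef_spectral[U [d [uU d0 AE ->]]]; rewrite [RHS]AE.
suff -> : map_mx (fun x : R => x `^ 1) d = d by [].
by apply/rowP => i; rewrite !mxE powRr1// ltW.
Qed.

Lemma mxpowR_adj A s : posdef A -> (mxpowR A s)^t* = mxpowR A s.
Proof. by move=> /(mxpowR_posdef s)/posdef_adj. Qed.

Lemma mxpowR_whiten A : posdef A ->
  mxpowR A (- 2^-1) *m A *m (mxpowR A (- 2^-1))^t* = 1%:M.
Proof.
move=> pA; rewrite mxpowR_adj// -{2}(mxpowR1 pA) !mxpowRD// -(mxpowR0 pA).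
congr mxpowR; lra.
Qed.

(** Operator monotonicity of the square root. From Y^2 - X^2 = X (Y - X) + (Y - X) Y, the form of
    Y^2 - X^2 at an eigenvector of Y - X with eigenvalue d equals d times the sum of the forms of X
    and Y. That sum is positive, so d >= 0. *)
Lemma loewner_sqr X Y : posdef X -> posdef Y ->
  loewner (X *m X) (Y *m Y) -> loewner X Y.
Proof.
move=> /posdefP[hX pX] /posdefP[hY pY] XY.
have hZ : (Y - X)^t* = Y - X by rewrite adjB hX hY.
have [U [d [uU ZE _]]] := herm_spectral hZ; have /unitarymxP UU := uU.
have d0 i : 0 <= d 0 i.
  pose e : 'rV[C]_n := delta_mx 0 i; pose v := e *m U.
  have v0 : v != 0 by exact/mulmx_unitary_neq0/delta_mx_neq0.
  have vZ : v *m (Y - X) = (d 0 i)%:C *: v.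
    rewrite ZE /v -!mulmxA (mulmxA U) UU mul1mx (mulmxA e) scalemxAl; congr (_ *m _).
    apply/rowP => j; rewrite /rdiag mul_mx_diag !mxE eqxx /=.
    by case: eqVneq => [->|_]; rewrite ?(mulr1, mul1r, mulr0, mul0r).
  have Zv : (Y - X) *m v^t* = (d 0 i)%:C *: v^t*.
    by rewrite -{1}hZ -adjM vZ adjZ; congr (_ *: _); exact: conjc_real.
  have : 0 <= qform (Y *m Y - X *m X) v by rewrite qformB subr_ge0.
  have -> : Y *m Y - X *m X = X *m (Y - X) + (Y - X) *m Y.
    by rewrite mulmxBr mulmxBl [RHS]addrC addrA subrK.
  have -> : qform (X *m (Y - X) + (Y - X) *m Y) v =
      d 0 i * (qform X v + qform Y v).
    rewrite qformD /qform !mulmxA vZ -[v *m X *m _ *m _]mulmxA Zv.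
    have ReZ a (B : 'M[C]_1) : complex.Re ((a%:C *: B) 0 0) = a * complex.Re (B 0 0).
      by rewrite mxE; case: (B 0 0) => x y /=; rewrite mul0r subr0.
    by rewrite -scalemxAr -!scalemxAl !ReZ mulrDr.
  by rewrite pmulr_lge0// addr_gt0// (pX, pY).
move=> v; rewrite -subr_ge0 -qformB ZE -[v](mulmx1) -(mulmxKtV 1%:M uU)//.
rewrite mul1mx mulmxA qform_unitary// qform_rdiag sumr_ge0// => i _.
by rewrite mulr_ge0// sqr_ge0.
Qed.

Lemma herm_qform_eq0 A : A^t* = A -> (forall v, qform A v = 0) -> A = 0.
Proof.
move=> /herm_spectral[U [d [uU -> _]]] h.
suff -> : d = 0 by rewrite /rdiag map_mx0 linear0 mulmx0 mul0mx.
by apply/rowP => i; rewrite mxE -qform_rdiag_delta -(qform_unitary _ _ uU) h.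
Qed.

Lemma posdef_sqr_inj X Y : posdef X -> posdef Y -> X *m X = Y *m Y -> X = Y.
Proof.
move=> pX pY XY; apply/eqP; rewrite -subr_eq0; apply/eqP/herm_qform_eq0.
  by rewrite adjB !posdef_adj.
move=> v; apply/eqP; rewrite qformB subr_eq0 eq_le.
by rewrite !loewner_sqr// => w; rewrite XY.
Qed.

(** The eigenbasis chosen for the identity is some unspecified unitary; conjugating back by it shows
    that the eigenvalues are 1. *)
Lemma mxpowR_one s : mxpowR (1%:M : M) s = 1%:M.
Proof.
have [U [e [uU _ E pE]]] := posdef_spectral posdef1.
have /unitarymxP UU := uU; have UU' := mulmx1C UU.
have e1 : rdiag e = rdiag (const_mx 1).
  rewrite rdiag1 -[LHS]mul1mx -[LHS]mulmx1 -UU !mulmxA -(mulmxA U) -(mulmxA U).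
  by rewrite -E mulmx1.
rewrite pE; have -> : map_mx (fun x : R => x `^ s) e = const_mx 1.
  apply/rowP => i; rewrite !mxE.
  have := congr1 (fun Z => qform Z (delta_mx 0 i)) e1.
  by rewrite !qform_rdiag_delta mxE => ->; rewrite powR1.
by rewrite rdiag1 mulmx1.
Qed.

Lemma mxpowR_conj A p s : posdef A ->
  mxpowR A p *m mxpowR A s *m (mxpowR A p)^t* = mxpowR A (p + s + p).
Proof. by move=> pA; rewrite (mxpowR_adj _ pA) !(mxpowRD _ _ pA). Qed.

Lemma mxpowR_unit A s : posdef A -> mxpowR A s \in unitmx.
Proof. by move=> pA; exact/posdef_unit/mxpowR_posdef. Qed.

(** The eigenbases chosen for A and for A^s are unrelated, so the two sides are compared through
    uniqueness of the positive square root. *)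
Lemma mxpowR_half A s : posdef A -> mxpowR (mxpowR A s) 2^-1 = mxpowR A (s / 2).
Proof.
move=> pA; have pAs := mxpowR_posdef s pA.
apply: posdef_sqr_inj; [exact: mxpowR_posdef..|].
rewrite (mxpowRD _ _ pA) (mxpowRD _ _ pAs) -splitr.
have -> : 2^-1 + 2^-1 = 1 :> R by lra.
by rewrite mxpowR1.
Qed.

End Powers.

(** * Unitarily invariant norms *)

Section NormTheory.
Context {R : realType} {n : nat}.
Local Notation C := R[i].
Local Notation M := 'M[C]_n.
Implicit Types (A B S T U X Y : M) (v : 'rV[C]_n) (d : 'rV[R]_n).

Lemma normcR (x : R) : Normc.normc x%:C = `|x|.
Proof. by rewrite /= expr0n /= addr0 sqrtr_sqr. Qed.

Lemma adj_unitary U : U \is unitarymx -> U^t* \is unitarymx.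
Proof. by rewrite trmxC_unitary. Qed.

Lemma uinorm_adj (N : M -> R) : unitarily_invariant_norm N ->
  unitarily_invariant_norm (fun A => N (A^t*)).
Proof.
move=> hN; split.
- by move=> A B; rewrite adjD uinorm_triangle.
- move=> a A; rewrite adjZ (uinorm_scale hN); congr (_ * _).
  by case: a => x y /=; rewrite sqrrN.
- by move=> A /(uinorm_eq0 hN) h; rewrite -(trmxCK A) h trmx0 map_mx0.
- move=> A U V uU uV; rewrite !adjM mulmxA.
  exact: (uinorm_unitary hN (A^t*) (adj_unitary uV) (adj_unitary uU)).
Qed.

Variable N : M -> R.
Hypothesis hN : unitarily_invariant_norm N.

Lemma uinormZ (a : R) A : N (a%:C *: A) = `|a| * N A.
Proof. by rewrite (uinorm_scale hN) normcR. Qed.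

Lemma uinorm0 : N 0 = 0.
Proof. by have := uinormZ 0 0; rewrite scaler0 normr0 mul0r. Qed.

Lemma uinormN A : N (- A) = N A.
Proof.
have -> : - A = (-1)%:C *: A by rewrite rmorphN rmorph1 scaleN1r.
by rewrite uinormZ normrN1 mul1r.
Qed.

Lemma uinorm_ge0 A : 0 <= N A.
Proof.
have := uinorm_triangle hN A (- A); rewrite subrr uinorm0 uinormN; lra.
Qed.

Lemma uinorm_sum (I : Type) (r : seq I) (P : pred I) (F : I -> M) :
  N (\sum_(i <- r | P i) F i) <= \sum_(i <- r | P i) N (F i).
Proof.
elim/big_rec2: _ => [|i y z _ h]; first by rewrite uinorm0.
by apply: le_trans (uinorm_triangle hN _ _) _; rewrite lerD2l.
Qed.

Lemma uinorm_entries A :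
  N A <= \sum_i \sum_j Normc.normc (A i j) * N (delta_mx i j).
Proof.
rewrite [X in N X]matrix_sum_delta; apply: le_trans (uinorm_sum _ _ _) _.
apply: ler_sum => i _; apply: le_trans (uinorm_sum _ _ _) _.
by apply: ler_sum => j _; rewrite (uinorm_scale hN).
Qed.

Lemma uinorm_mull U A : U \is unitarymx -> N (U *m A) = N A.
Proof.
move=> uU; have u1 : (1%:M : M) \is unitarymx.
  by apply/unitarymxP; rewrite adj1 mulmx1.
by rewrite -[U *m A]mulmx1; exact: (uinorm_unitary hN A uU u1).
Qed.

Lemma unitary_diag (u : 'rV[C]_n) : (forall i, u 0 i * conjc (u 0 i) = 1) ->
  diag_mx u \is unitarymx.
Proof.
move=> hu; apply/unitarymxP; rewrite tr_diag_mx map_diag_mx mul_mx_diag.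
apply/matrixP => i j; rewrite !mxE; case: eqVneq => [->|_].
  by rewrite !mulr1n; exact: hu.
by rewrite !mulr0n mul0r.
Qed.

(** A mean of two diagonal unitaries is a contraction for N; the bounds on diagonal factors below
    come from this. *)
Lemma uinorm_diag_mean (u w : 'rV[C]_n) A :
  (forall i, u 0 i * conjc (u 0 i) = 1) ->
  (forall i, w 0 i * conjc (w 0 i) = 1) ->
  N (diag_mx (2^-1%:C *: (u + w)) *m A) <= N A.
Proof.
move=> hu hw; rewrite linearZ linearD /= -scalemxAl uinormZ mulmxDl.
have := uinorm_triangle hN (diag_mx u *m A) (diag_mx w *m A).
rewrite !uinorm_mull; [|exact: unitary_diag..].
by rewrite ger0_norm ?invr_ge0//; lra.
Qed.

(** A number d in [0, 1] is the mean of the two unimodular numbers d + i e and d - i e with e =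
    sqrt(1 - d^2). *)
Lemma uinorm_rdiag_le d A : (forall i, 0 <= d 0 i <= 1) -> N (rdiag d *m A) <= N A.
Proof.
move=> d01; pose e i := Num.sqrt (1 - d 0 i ^+ 2).
have eE i : d 0 i ^+ 2 + e i ^+ 2 = 1.
  by rewrite sqr_sqrtr ?subrKC//; have := d01 i; nra.
pose u : 'rV[C]_n := \row_i (d 0 i +i* e i); pose w : 'rV[C]_n := \row_i (d 0 i -i* e i).
rewrite /rdiag; have -> : map_mx (real_complex R) d = 2^-1%:C *: (u + w).
  apply/rowP => i; rewrite !mxE; apply/eqP; rewrite eq_complex /=.
  by apply/andP; split; apply/eqP; field.
apply: uinorm_diag_mean => i; rewrite !mxE; apply/eqP; rewrite eq_complex /=.
  by rewrite -(eE i); apply/andP; split; apply/eqP; ring.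
by rewrite -(eE i); apply/andP; split; apply/eqP; ring.
Qed.

Lemma whiten_unit A S : S *m A *m S^t* = 1%:M -> S \in unitmx.
Proof. by rewrite -mulmxA => /mulmx1_unit[]. Qed.

Lemma whiten_unitary A S T : S *m A *m S^t* = 1%:M -> T *m A *m T^t* = 1%:M ->
  T *m invmx S \is unitarymx.
Proof.
move=> hS hT; have uS := whiten_unit hS.
apply/unitarymxP; rewrite -hT adjM !mulmxA; congr (_ *m _).
rewrite -!mulmxA; congr (_ *m _).
apply: (can_inj (mulKmx uS)); apply: (can_inj (mulmxK (adj_unit uS))).
by rewrite hS mulmxA (mulmxV uS) mul1mx -adjM (mulmxV uS) adj1.
Qed.

(** Two matrices that whiten A differ by a unitary left factor, invisible to N. So A^(-1/2) may be
    replaced by whichever whitening matrix suits a given congruence or eigenbasis. *)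
Lemma uinorm_whitenl A S T Y : S *m A *m S^t* = 1%:M ->
  T *m A *m T^t* = 1%:M -> N (T *m Y) = N (S *m Y).
Proof.
move=> hS hT; rewrite -(uinorm_mull (S *m Y) (whiten_unitary hS hT)).
by rewrite mulmxA mulmxKV// (whiten_unit hS).
Qed.

(** Diagonalize T A T^* as U^* h U; then V = h^(-1/2) U T whitens A and T = U^* h^(1/2) V. Since c A
    <= B forces h <= 1/c, the factor h^(1/2) is sqrt(1/c) times a diagonal contraction. *)
Lemma uinorm_loewnerl A B S T Y (c : R) : posdef A -> 0 < c ->
  loewner (c%:C *: A) B -> S *m A *m S^t* = 1%:M -> T *m B *m T^t* = 1%:M ->
  N (T *m Y) <= Num.sqrt c^-1 * N (S *m Y).
Proof.
move=> pA c0 AB hS hT; have uS := whiten_unit hS; have uT := whiten_unit hT.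
have [U [h [uU h0 HE _]]] := posdef_spectral (posdef_conj uT pA).
have /unitarymxP UU := uU.
(* Test c A <= B at the row e U T, where the form of B is 1 because T whitens B and U is unitary. *)
have hc i : h 0 i <= c^-1.
  pose e : 'rV[C]_n := delta_mx 0 i.
  rewrite -(qform_rdiag_delta h i) -(qform_unitary _ _ uU) -HE -/e qform_conj.
  have := AB (e *m U *m T); rewrite qformZ -(qform_conj B) hT.
  have -> : 1%:M = U^t* *m rdiag (const_mx 1) *m U.
    by rewrite rdiag1 mulmx1; apply/esym/mulmx1C.
  rewrite qform_unitary// qform_rdiag_delta mxE => ?.
  by rewrite -(ler_pM2l c0) divff ?gt_eqF.
pose hs := map_mx (fun x : R => Num.sqrt x) h.
pose hi := map_mx (fun x : R => (Num.sqrt x)^-1) h.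
have shi : rdiag hs *m rdiag hi = 1%:M.
  rewrite rdiagM -rdiag1; congr rdiag; apply/rowP => i; rewrite !mxE.
  by rewrite divff// gt_eqF// sqrtr_gt0.
pose V := rdiag hi *m (U *m T).
have hV : V *m A *m V^t* = 1%:M.
  rewrite /V !adjM rdiag_adj.
  have -> : rdiag hi *m (U *m T) *m A *m (T^t* *m U^t* *m rdiag hi) =
     rdiag hi *m (U *m (T *m A *m T^t*) *m U^t*) *m rdiag hi by rewrite !mulmxA.
  have -> : U *m (T *m A *m T^t*) *m U^t* = rdiag h.
    by rewrite HE !mulmxA UU mul1mx -mulmxA UU mulmx1.
  rewrite !rdiagM -rdiag1.
  congr rdiag; apply/rowP => i; rewrite !mxE.
  have s0 : Num.sqrt (h 0 i) != 0 by rewrite gt_eqF// sqrtr_gt0 h0.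
  have {2}-> : h 0 i = Num.sqrt (h 0 i) ^+ 2 by rewrite sqr_sqrtr ?ltW.
  by field.
have -> : N (T *m Y) = N (rdiag hs *m (V *m Y)).
  by rewrite /V !mulmxA shi mul1mx -!mulmxA (uinorm_mull _ uU).
have -> : rdiag hs = (Num.sqrt c^-1)%:C *:
    rdiag (\row_i (Num.sqrt c * hs 0 i)).
  rewrite /rdiag -linearZ /=; congr diag_mx; apply/rowP => i; rewrite !mxE.
  by rewrite -rmorphM mulrA -sqrtrM ?invr_ge0 ?ltW// mulVf ?gt_eqF// sqrtr1 mul1r.
rewrite -scalemxAl uinormZ ger0_norm ?sqrtr_ge0// ler_wpM2l ?sqrtr_ge0//.
rewrite (uinorm_whitenl Y hV hS); apply: uinorm_rdiag_le => i.
rewrite !mxE mulr_ge0 ?sqrtr_ge0//= -(sqrtrM _ (ltW c0)).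
have : c * h 0 i <= 1 by rewrite -(mulfV (lt0r_neq0 c0)) ler_pM2l ?hc.
by move=> /ler_wsqrtr; rewrite sqrtr1.
Qed.

End NormTheory.

(** * Schur multipliers *)

Section SchurMultipliers.
Context {R : realType} {n : nat}.
Local Notation C := R[i].
Local Notation M := 'M[C]_n.
Implicit Types (W : M) (x y : 'I_n -> R).

Lemma conjc_involutive (z : C) : conjc (conjc z) = z.
Proof. by case: z => a b /=; rewrite opprK. Qed.

Lemma uinorm_row_unit (N : M -> R) (u : 'I_n -> C) W : unitarily_invariant_norm N ->
  (forall i, u i * conjc (u i) = 1) -> N (\matrix_(i, j) (u i * W i j)) = N W.
Proof.
move=> hN hu; have uU : diag_mx (\row_i u i) \is unitarymx.
  by apply: unitary_diag => i; rewrite mxE.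
rewrite -(uinorm_mull hN W uU) mul_diag_mx; congr N.
by apply/matrixP => i j; rewrite !mxE.
Qed.

Lemma uinorm_col_unit (N : M -> R) (u : 'I_n -> C) W : unitarily_invariant_norm N ->
  (forall i, u i * conjc (u i) = 1) -> N (\matrix_(i, j) (u j * W i j)) = N W.
Proof.
move=> hN hu.
have hu' i : conjc (u i) * conjc (conjc (u i)) = 1 by rewrite conjc_involutive mulrC.
have := uinorm_row_unit (W^t*) (uinorm_adj hN) hu'; rewrite trmxCK => <-.
congr N; apply/matrixP => i j; rewrite !mxE rmorphM.
by congr (_ * _); exact/esym/conjc_involutive.
Qed.

(** Dividing row i by 1 + i x_i is a contraction: 1 / (1 + i x) = (1 + w) / 2, where the Cayley
    transform w = (1 - i x) / (1 + i x) is unimodular. *)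
Lemma uinorm_row_expand (N : M -> R) x W : unitarily_invariant_norm N ->
  N W <= N (\matrix_(i, j) ((1 +i* x i) * W i j)).
Proof.
move=> hN; set W' := \matrix_(i, j) _.
have x0 i : 1 + x i ^+ 2 != 0 by rewrite gt_eqF// ltr_pwDl// sqr_ge0.
pose w : 'rV[C]_n := \row_i ((1 -i* x i) / (1 +i* x i)).
have wE i : w 0 i = ((1 - x i ^+ 2) / (1 + x i ^+ 2) -i* (2 * x i / (1 + x i ^+ 2))).
  rewrite mxE; apply/eqP; rewrite eq_complex /= expr1n.
  by apply/andP; split; apply/eqP; field.
have -> : W = diag_mx (2^-1%:C *: (const_mx 1 + w)) *m W'.
  apply/matrixP => i j; rewrite mul_diag_mx !mxE -[LHS]mul1r mulrA.
  congr (_ * _); rewrite -/(w 0 i).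
  have := wE i; rewrite mxE => ->.
  apply/eqP; rewrite eq_complex /=.
  by apply/andP; split; apply/eqP; field.
apply: uinorm_diag_mean => // i.
  by rewrite mxE conjc1 mulr1.
rewrite wE; apply/eqP; rewrite eq_complex /=.
by apply/andP; split; apply/eqP; field.
Qed.

Lemma uinorm_col_expand (N : M -> R) x W : unitarily_invariant_norm N ->
  N W <= N (\matrix_(i, j) ((1 -i* x j) * W i j)).
Proof.
move=> hN; have := uinorm_row_expand x (W^t*) (uinorm_adj hN).
rewrite trmxCK => /le_trans -> //; rewrite le_eqVlt; apply/orP; left; apply/eqP.
congr N; apply/matrixP => i j; rewrite !mxE rmorphM; congr (_ * _).
exact: conjc_involutive.
Qed.

Variable N : M -> R.
Hypothesis hN : unitarily_invariant_norm N.

Let eq_mx_le (A B : M) : A = B -> N A <= N B. Proof. by move=> ->. Qed.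

(* W |-> i (x_i - y_j) W generates a group of isometries for N, so 1 plus this
   generator expands N. The group is approximated by Cayley transforms with
   step h, and the denominators are cleared to get polynomials in h. *)
Lemma uinorm_generator_expand x y W :
  N W <= N (\matrix_(i, j) ((1 +i* (x i - y j)) * W i j)).
Proof.
set G := \matrix_(i, j) _.
pose G1 : M := \matrix_(i, j) ((0 +i* (x i - y j)) * W i j).
pose G2 : M := \matrix_(i, j) ((x i * y j)%:C * W i j).
have step h : 0 < h -> h <= 1 -> N W <= N G + h * (N G1 + N G2).
  move=> h0 h1.
  pose W' : M := \matrix_(i, j) ((1 +i* (h * x i)) * ((1 -i* (h * y j)) * W i j)).
  have WW' : N W <= N W'.
    apply: le_trans (uinorm_col_expand (fun j => h * y j) W hN) _.
    apply: le_trans (uinorm_row_expand (fun j => h * x j) _ hN) _.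
    by apply: eq_mx_le; apply/matrixP => i j; rewrite !mxE.
  pose u t : C := (1 -i* (h * t)) / (1 +i* (h * t)).
  have ht t : 1 + (h * t) ^+ 2 != 0 by rewrite gt_eqF// ltr_pwDl// sqr_ge0.
  have uE t : u t = ((1 - (h * t) ^+ 2) / (1 + (h * t) ^+ 2)
                       -i* (2 * (h * t) / (1 + (h * t) ^+ 2))).
    apply/eqP; rewrite eq_complex /= expr1n.
    by apply/andP; split; apply/eqP; field.
  have u1 t : u t * conjc (u t) = 1.
    rewrite uE; apply/eqP; rewrite eq_complex /=.
    by apply/andP; split; apply/eqP; field.
  have u2 t : u t * (1 +i* (h * t)) = 1 -i* (h * t).
    rewrite uE; apply/eqP; rewrite eq_complex /=.
    by apply/andP; split; apply/eqP; field.
  pose W2 : M := \matrix_(i, j) ((1 -i* (h * x i)) * ((1 +i* (h * y j)) * W i j)).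
  have NW2 : N W2 = N W'.
    rewrite -(uinorm_row_unit W' hN (fun i => u1 (x i))).
    have := uinorm_col_unit (\matrix_(i, j) (u (x i) * W' i j)) hN (fun j => u1 (- y j)).
    move=> <-; congr N.
    apply/matrixP => i j; rewrite !mxE (mulrA (u (x i))) u2 [RHS]mulrCA (mulrA (u _)).
    have -> : 1 -i* (h * y j) = 1 +i* (h * - y j) by rewrite mulrN.
    by rewrite u2 mulrN opprK.
  (* [W2] differs from [W'] by unimodular row and column factors, so both have the same norm. The
     triangle inequality thus gives (1 + 2h) N(W') <= 2h N(G + O(h)) + N(W'), and after cancellation
     N(W') <= N(G + O(h)). *)
  have E : (1 + 2 * h)%:C *: W' - W2 = (2 * h)%:C *: (G + h%:C *: (G1 + h%:C *: G2)).
    apply/matrixP => i j; rewrite !mxE; case: (W i j) => a b.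
    apply/eqP; rewrite eq_complex /=.
    by apply/andP; split; apply/eqP; ring.
  have := uinorm_triangle hN ((1 + 2 * h)%:C *: W' - W2) W2.
  rewrite subrK E !(uinormZ hN) NW2 !ger0_norm; [|lra..].
  have := uinorm_triangle hN G (h%:C *: (G1 + h%:C *: G2)).
  have := uinorm_triangle hN G1 (h%:C *: G2).
  rewrite !(uinormZ hN) !ger0_norm; [|lra..].
  have := uinorm_ge0 hN G2; have := uinorm_ge0 hN G1.
  move: (N W) (N W') (N G) (N G1) (N G2) (N (G1 + _)) (N (G + _)) WW'.
  move=> a b c d e f g ab d0 e0 fde gcf bg.
  have {}bg : b <= g by rewrite -(@ler_pM2l _ (2 * h)); lra.
  have hf : h * f <= h * (d + h * e) by rewrite ler_pM2l.
  have he : h * (h * e) <= h * e by rewrite ler_pM2l// ler_piMl.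
  lra.
have K0 : 0 <= N G1 + N G2 by rewrite addr_ge0 ?uinorm_ge0.
apply/ler_addgt0Pr => e e0.
pose h := Num.min 1 (e / (N G1 + N G2 + 1)).
have h0 : 0 < h by rewrite lt_min ltr01/= divr_gt0//; lra.
apply: le_trans (step h h0 _) _; first by rewrite ge_min lexx.
rewrite lerD2l; apply: (@le_trans _ _ (h * (N G1 + N G2 + 1))).
  by rewrite ler_pM2l//; lra.
by rewrite -ler_pdivlMr ?ge_min ?lexx ?orbT//; lra.
Qed.

Lemma uinorm_generators_expand (ts : seq R) x y W :
  N W <= N (\matrix_(i, j) ((\prod_(t <- ts) (1 +i* (t * (x i - y j)))) * W i j)).
Proof.
elim: ts => [|t ts IH].
  apply: eq_mx_le.
  by apply/matrixP => i j; rewrite !mxE big_nil mul1r.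
apply: le_trans IH _.
apply: le_trans (uinorm_generator_expand (fun i => t * x i) (fun i => t * y i) _) _.
apply: eq_mx_le.
by apply/matrixP => i j; rewrite !mxE big_cons -mulrBr mulrA.
Qed.

End SchurMultipliers.

(** * The hyperbolic cosine as a limit of products of factors 1 + i t z *)

Section Cosh.
Context {R : realType}.
Local Notation C := R[i].

(** Both bounds of the squeeze come from 1 + x <= exp x: taken at y = z/n it gives the upper one,
    and at -y / (1 + y), where 1 + x = 1 / (1 + y), the lower one exp(z / (1 + y)). *)
Lemma cvg_expR_limit (z : R) : (1 + z / n%:R) ^+ n @[n --> \oo] --> expR z.
Proof.
have zn : z / n%:R @[n --> \oo] --> (0 : R).
  rewrite -(mulr0 z); apply: cvgMr; apply/cvgrPdist_lt => e e0.
  near=> n; rewrite sub0r normrN ger0_norm ?invr_ge0 ?ler0n//.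
  rewrite invf_plt ?posrE//; first by near: n; exact: nbhs_infty_gtr.
  by rewrite ltr0n; near: n; exact: nbhs_infty_gt.
have low : expR (z / (1 + z / n%:R)) @[n --> \oo] --> expR z.
  apply: continuous_cvg; first exact: continuous_expR.
  rewrite -[X in _ --> X]mulr1; apply: cvgMr.
  rewrite -[X in _ --> X]invr1; apply: cvgV; first exact: oner_neq0.
  by rewrite -[X in _ --> X](addr0 1); apply: cvgD => //; exact: cvg_cst.
apply: (squeeze_cvgr _ low (cvg_cst (expR z))).
near=> n.
have n0 : (0 : R) < n%:R by rewrite ltr0n; near: n; exact: nbhs_infty_gt.
have y1 : `|z / n%:R| < 1.
  by near: n; move/cvgrPdist_lt : zn => /(_ 1 ltr01); under eq_near do rewrite sub0r normrN.
have y0 : 0 < 1 + z / n%:R by move: y1; rewrite ltr_norml => /andP[? _]; lra.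
have nz : 0 < n%:R + z.
  have -> : n%:R + z = (1 + z / n%:R) * n%:R by field; rewrite gt_eqF.
  exact: mulr_gt0.
apply/andP; split.
  have -> : z / (1 + z / n%:R) = n%:R * (z / n%:R / (1 + z / n%:R)).
    by field; rewrite !gt_eqF.
  rewrite expRM_natl; apply: lerXn2r; rewrite ?nnegrE ?expR_ge0 ?(ltW y0)//.
  have := expR_ge1Dx (- (z / n%:R / (1 + z / n%:R))).
  have -> : 1 + - (z / n%:R / (1 + z / n%:R)) = (1 + z / n%:R)^-1.
    by field; rewrite !gt_eqF.
  by rewrite expRN lef_pV2 ?posrE ?expR_gt0.
have -> : expR z = expR (z / n%:R) ^+ n.
  by rewrite -expRM_natl; congr expR; field; rewrite gt_eqF.
by apply: lerXn2r; rewrite ?nnegrE ?expR_ge0 ?expR_ge1Dx ?(ltW y0).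
Unshelve. all: by end_near. Qed.

(* Every root r of the left-hand side, a polynomial in z, satisfies
   |1 + r| = |1 - r| and is therefore purely imaginary; the t are the 1/Im r. *)
Lemma half_sum_powers_factor (m : nat) : (0 < m)%N -> exists ts : seq R,
  forall z : R, (((1 + z) ^+ m + (1 - z) ^+ m) / 2)%:C = \prod_(t <- ts) (1 +i* (t * z)).
Proof.
move=> m0; pose p : {poly C} := 2^-1 *: ((1 + 'X) ^+ m + (1 - 'X) ^+ m).
have pE (z : C) : p.[z] = 2^-1 * ((1 + z) ^+ m + (1 - z) ^+ m).
  by rewrite /p !hornerE.
have p0 : p.[0] = 1.
  by rewrite pE addr0 subr0 expr1n -mulr2n mulVf// pnatr_eq0.
have [r pr] := closed_field_poly_normal p.
have rE z : p.[z] = lead_coef p * \prod_(a <- r) (z - a).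
  rewrite {1}pr hornerZ horner_prod; congr (_ * _).
  by apply: eq_bigr => a _; rewrite hornerXsubC.
have ra a : a \in r -> complex.Re a = 0 /\ complex.Im a != 0.
  move=> ar; have /eqP : p.[a] = 0.
    by rewrite rE (big_rem a ar) /= subrr mul0r mulr0.
  rewrite pE mulf_eq0 invr_eq0 pnatr_eq0 /= addr_eq0 => /eqP/(congr1 Num.norm).
  rewrite normrN !normrX => /eqP; rewrite eqrXn2// => /eqP/(congr1 (fun x => x ^+ 2)).
  rewrite -!add_Re2_Im2 => /complexI; case: a ar => x y ar /=.
  move=> h; have x0 : x = 0 by lra.
  split=> //; apply: contraPneq p0 => y0; rewrite rE (big_rem _ ar) /= x0 y0.
  by rewrite subrr mul0r mulr0 => /esym/eqP; rewrite oner_eq0.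
exists [seq (complex.Im a)^-1 | a <- r] => z.
have -> : (((1 + z) ^+ m + (1 - z) ^+ m) / 2)%:C = p.[z%:C].
  by rewrite pE mulrC rmorphM rmorphD !rmorphXn /= rmorphD rmorphB rmorph1 fmorphV /= rmorph_nat.
(* Dividing by p(0) = 1 cancels the leading coefficient and turns z - a into 1 - z/a, which is 1 + i
   z/y for a root a = i y. *)
have -> : p.[z%:C] = p.[z%:C] / p.[0] by rewrite p0 divr1.
rewrite !rE big_map.
have lp : lead_coef p != 0.
  by apply: contra_eq_neq p0 => lp0; rewrite rE lp0 mul0r eq_sym oner_eq0.
have h0 : \prod_(a <- r) (0 - a) != 0.
  rewrite prodf_seq_neq0; apply/allP => a /ra[_ ai] /=.
  by rewrite sub0r oppr_eq0; apply: contra ai => /eqP ->.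
rewrite -mulf_div divff// mul1r -prodf_div; apply: eq_big_seq => a /ra[].
case: a => x y /= -> y0; apply/eqP; rewrite eq_complex /=.
by apply/andP; split; apply/eqP; field.
Qed.

End Cosh.

(** * The hyperbolic cosine as an expanding Schur multiplier *)

Section CPR.
Context {R : realType} {n : nat}.
Local Notation C := R[i].
Local Notation M := 'M[C]_n.
Variable N : M -> R.
Hypothesis hN : unitarily_invariant_norm N.

(* The Corach-Porta-Recht inequality, 2 N(W) <= N(S W T^-1 + S^-1 W T), in
   the eigenbases of the positive matrices S and T. *)
Lemma uinorm_cosh_expand (x y : 'I_n -> R) (W : M) :
  N W <= N (\matrix_(i, j)
    (((expR (x i - y j) + expR (- (x i - y j))) / 2)%:C * W i j)).
Proof.
set W' := \matrix_(i, j) _.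
pose ch (z : R) := (expR z + expR (- z)) / 2.
(* [c m] tends to cosh and factors into terms 1 + i t z, each of them an expanding multiplier; [e m]
   dominates the norm of the error made by replacing cosh with [c m]. *)
pose c (m : nat) (z : R) := ((1 + z / m%:R) ^+ m + (1 + (- z) / m%:R) ^+ m) / 2.
pose d i j := Normc.normc (W i j) * N (delta_mx i j).
pose e m := \sum_i \sum_j `|ch (x i - y j) - c m (x i - y j)| * d i j.
have step m : (0 < m)%N -> N W <= N W' + e m.
  move=> m0; have [ts ts_E] := @half_sum_powers_factor R m m0.
  apply: le_trans (uinorm_generators_expand hN ts (fun i => x i / m%:R)
    (fun i => y i / m%:R) W) _.
  set W1 := \matrix_(i, j) _; rewrite -[W1](subrKC W').
  apply: le_trans (uinorm_triangle hN _ _) _; rewrite lerD2l.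
  apply: le_trans (uinorm_entries hN _) _; apply: ler_sum => i _; apply: ler_sum => j _.
  rewrite /d mulrA ler_wpM2r ?uinorm_ge0//.
  have -> : (W1 - W') i j = (c m (x i - y j) - ch (x i - y j))%:C * W i j.
    rewrite !mxE -mulrBl -mulrBl; congr (_ * _); rewrite -ts_E rmorphB /=.
    by rewrite /c mulNr.
  by rewrite Normc.normcM normcR distrC.
have ce z : ch z - c m z @[m --> \oo] --> (0 : R).
  rewrite -(subrr (ch z)); apply: cvgB; first exact: cvg_cst.
  by apply: cvgMl; apply: cvgD; exact: cvg_expR_limit.
have e0 : e m @[m --> \oo] --> (0 : R).
  have -> : (0 : R) = \sum_(i < n) \sum_(j < n) (`|0 : R| * d i j).
    by rewrite big1// => i _; rewrite big1// => j _; rewrite normr0 mul0r.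
  apply: cvg_big => [|i _]; first exact: add_continuous.
  apply: cvg_big => [|j _]; first exact: add_continuous.
  apply: cvgMl; apply: cvg_norm.
  exact: ce.
have : N W' + e m @[m --> \oo] --> N W' + 0 by apply: cvgD => //; exact: cvg_cst.
rewrite addr0 => /cvgr_to_ge; apply; near=> m; apply: step.
by near: m; exact: nbhs_infty_gt.
Unshelve. all: by end_near. Qed.

End CPR.

(** * Chains of positive definite matrices *)

Section RelativeNorm.
Context {R : realType} {n : nat}.
Local Notation C := R[i].
Local Notation M := 'M[C]_n.
Implicit Types (A B S T X Y : M).

Variable N : M -> R.
Hypothesis hN : unitarily_invariant_norm N.

Lemma uinorm_whitenr B S T Y : S *m B *m S^t* = 1%:M ->
  T *m B *m T^t* = 1%:M -> N (Y *m T^t*) = N (Y *m S^t*).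
Proof.
move=> hS hT; have := uinorm_whitenl (uinorm_adj hN) (Y^t*) hS hT.
by rewrite !adjM !trmxCK.
Qed.

Lemma uinorm_loewnerr A B S T Y (c : R) : posdef A -> 0 < c ->
  loewner (c%:C *: A) B -> S *m A *m S^t* = 1%:M -> T *m B *m T^t* = 1%:M ->
  N (Y *m T^t*) <= Num.sqrt c^-1 * N (Y *m S^t*).
Proof.
move=> pA c0 AB hS hT.
have := uinorm_loewnerl (uinorm_adj hN) (Y^t*) pA c0 AB hS hT.
by rewrite !adjM !trmxCK.
Qed.

Definition relnorm A B : R :=
  N (mxpowR A (- 2^-1) *m (B - A) *m mxpowR B (- 2^-1)).

Lemma relnorm_ge0 A B : 0 <= relnorm A B.
Proof. exact: uinorm_ge0 hN _. Qed.

Lemma relnormE A B S T : posdef A -> posdef B ->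
  S *m A *m S^t* = 1%:M -> T *m B *m T^t* = 1%:M ->
  relnorm A B = N (S *m (B - A) *m T^t*).
Proof.
move=> pA pB hS hT; rewrite /relnorm -[X in _ *m X](mxpowR_adj _ pB).
rewrite (uinorm_whitenr _ hT (mxpowR_whiten pB)).
rewrite -(mulmxA _ (B - A)) -(mulmxA S).
exact: (uinorm_whitenl hN _ hS (mxpowR_whiten pA)).
Qed.

(** If S whitens A, then S X^-1 whitens X A X^*, and in the product with these whitenings X
    cancels. *)
Lemma relnorm_conj X A B : X \in unitmx -> posdef A -> posdef B ->
  relnorm (X *m A *m X^t*) (X *m B *m X^t*) = relnorm A B.
Proof.
move=> uX pA pB.
have wh S Z : S *m Z *m S^t* = 1%:M ->
    (S *m invmx X) *m (X *m Z *m X^t*) *m (S *m invmx X)^t* = 1%:M.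
  move=> hS; rewrite adjM !mulmxA (mulmxKV uX) -(mulmxA _ (X^t*)) -adjM.
  by rewrite (mulVmx uX) adj1 mulmx1.
have wA := mxpowR_whiten pA; have wB := mxpowR_whiten pB.
rewrite (relnormE (posdef_conj uX pA) (posdef_conj uX pB) (wh _ _ wA) (wh _ _ wB)).
rewrite (relnormE pA pB wA wB) adjM -mulmxBl -mulmxBr !mulmxA (mulmxKV uX).
by rewrite -(mulmxA _ (X^t*)) -adjM (mulVmx uX) adj1 mulmx1.
Qed.

(** The multiplier is 2 sinh(s (b_j - a_i) / 2), with a and b the logarithms of the eigenvalues, and
    Y = U V^* is the change of eigenbasis. As a, b and Y do not depend on s, different exponents can
    be compared. *)
Lemma relnorm_powR A B : posdef A -> posdef B ->
  exists (a b : 'I_n -> R) (Y : M), forall s,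
  relnorm (mxpowR A s) (mxpowR B s) =
  N (\matrix_(i, j) ((expR (s / 2 * (b j - a i)) - expR (- (s / 2 * (b j - a i))))%:C
     * Y i j)).
Proof.
move=> pA pB; have [U [d [uU d0 _ AE]]] := posdef_spectral pA.
have [V [e [uV e0 _ BE]]] := posdef_spectral pB.
have /unitarymxP UU := uU; have /unitarymxP VV := uV.
pose a i := ln (d 0 i); pose b i := ln (e 0 i).
exists a, b, (U *m V^t*) => s.
have wh (W Z : M) (f : 'rV[R]_n) : W *m W^t* = 1%:M -> (forall i, 0 < f 0 i) ->
    Z = W^t* *m rdiag (map_mx (fun x : R => x `^ s) f) *m W ->
    (rdiag (map_mx (fun x : R => x `^ (- (s / 2))) f) *m W) *m Z *m
    (rdiag (map_mx (fun x : R => x `^ (- (s / 2))) f) *m W)^t* = 1%:M.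
  move=> WW f0 ->; rewrite adjM rdiag_adj.
  have assoc (D1 D2 : M) : D1 *m W *m (W^t* *m D2 *m W) *m (W^t* *m D1) =
    D1 *m (W *m W^t*) *m D2 *m (W *m W^t*) *m D1 by rewrite !mulmxA.
  rewrite assoc {assoc}.
  rewrite WW !mulmx1 !rdiagM -rdiag1; congr rdiag; apply/rowP => i.
  have fi : f 0 i != 0 by rewrite gt_eqF// f0.
  rewrite !mxE -!powRD ?fi ?implybT//.
  by have -> : - (s / 2) + s + - (s / 2) = 0 by [lra]; rewrite powRr0.
rewrite (relnormE (mxpowR_posdef s pA) (mxpowR_posdef s pB)
  (wh _ _ _ UU d0 (AE s)) (wh _ _ _ VV e0 (BE s))).
have assoc (D1 D2 D3 D4 : M) :
    D1 *m U *m (V^t* *m D2 *m V - U^t* *m D3 *m U) *m (V^t* *m D4) =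
    D1 *m ((U *m V^t*) *m D2 - D3 *m (U *m V^t*)) *m D4.
  rewrite mulmxBr mulmxBl [in RHS]mulmxBr [in RHS]mulmxBl !mulmxA.
  by rewrite -(mulmxA _ V (V^t*)) VV mulmx1 -(mulmxA D1 U (U^t*)) UU mulmx1.
rewrite AE BE adjM rdiag_adj assoc {assoc}.
set Y := U *m V^t*; clearbody Y.
congr N; apply/matrixP => i j.
rewrite /rdiag mul_mx_diag mul_diag_mx mul_mx_diag mul_diag_mx !mxE.
have -> (p q r t : R) (z : C) : p%:C * (z * q%:C - r%:C * z) * t%:C =
    (p * (q - r) * t)%:C * z by rewrite !rmorphM rmorphB /=; ring.
have powE (x p : R) : 0 < x -> x `^ p = expR (p * ln x).
  by move=> x0; rewrite /powR gt_eqF.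
rewrite !powE ?d0 ?e0// -/(a i) -/(b j) mulrBr mulrBl -!expRD.
by congr ((expR _ - expR _)%:C * _); field.
Qed.

(** With z = (b_j - a_i) / 4, the multiplier at s = 1 is e^(2z) - e^(-2z) = (e^z - e^(-z)) (e^z +
    e^(-z)), which is the one at s = 1/2 times 2 cosh z. *)
Lemma relnorm_sqrt A B : posdef A -> posdef B ->
  relnorm (mxpowR A 2^-1) (mxpowR B 2^-1) <= 2^-1 * relnorm A B.
Proof.
move=> pA pB; have [a [b [Y h]]] := relnorm_powR pA pB.
have h1 := h 1; rewrite (mxpowR1 pA) (mxpowR1 pB) in h1; rewrite h1 (h 2^-1).
apply: le_trans (uinorm_cosh_expand hN (fun i => - (a i / 4)) (fun j => - (b j / 4)) _) _.
rewrite -[leRHS]ger0_norm ?mulr_ge0 ?invr_ge0 ?uinorm_ge0//.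
rewrite normrM (ger0_norm (uinorm_ge0 hN _)) -(uinormZ hN) le_eqVlt; apply/orP; left.
apply/eqP; congr N; apply/matrixP => i j; rewrite !mxE !mulrA -!rmorphM; congr (_%:C * _).
set z := 2^-1 / 2 * (b j - a i).
have -> : - (a i / 4) - - (b j / 4) = z by rewrite /z; field.
have -> : 1 / 2 * (b j - a i) = z + z by rewrite /z; field.
by rewrite opprD !expRD; ring.
Qed.

Definition nearby (th : R) A B :=
  loewner ((1 - th)%:C *: A) B /\ loewner ((1 - th)%:C *: B) A.

Lemma nearby_conj th A B X :
  nearby th A B -> nearby th (X *m A *m X^t*) (X *m B *m X^t*).
Proof.
have conj Y Z : loewner ((1 - th)%:C *: Y) Z ->
    loewner ((1 - th)%:C *: (X *m Y *m X^t*)) (X *m Z *m X^t*).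
  by move=> YZ v; rewrite scalemxAl scalemxAr !qform_conj.
by move=> [AB BA]; split; exact: conj.
Qed.

Lemma posdefZ (c : R) A : 0 < c -> posdef A -> posdef (c%:C *: A).
Proof.
move=> c0 /posdefP[hA pA]; apply/posdefP; split.
  by rewrite adjZ hA; congr (_ *: _); exact: conjc_real.
by move=> v v0; rewrite qformZ mulr_gt0// pA.
Qed.

Lemma posdef_qform_ge0 A v : posdef A -> 0 <= qform A v.
Proof.
move=> /posdefP[_ pA]; have [->|v0] := eqVneq v 0; last exact/ltW/pA.
by rewrite /qform !mul0mx mxE.
Qed.

(** ((1 - th) X^(1/2))^2 = (1 - th)^2 X <= (1 - th) X <= Y, and the square root is operator
    monotone. *)
Lemma nearby_sqrt th A B : 0 < th < 1 -> posdef A -> posdef B ->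
  nearby th A B -> nearby th (mxpowR A 2^-1) (mxpowR B 2^-1).
Proof.
move=> /andP[th0 th1] pA pB.
have sqrt_le X Y : posdef X -> posdef Y -> loewner ((1 - th)%:C *: X) Y ->
    loewner ((1 - th)%:C *: mxpowR X 2^-1) (mxpowR Y 2^-1).
  move=> pX pY XY; apply: loewner_sqr.
  - by apply: posdefZ; [lra|exact: mxpowR_posdef].
  - exact: mxpowR_posdef.
  have hh : 2^-1 + 2^-1 = 1 :> R by lra.
  move=> v; rewrite -scalemxAl -scalemxAr (mxpowRD _ _ pX) (mxpowRD _ _ pY) hh.
  rewrite (mxpowR1 pX) (mxpowR1 pY) qformZ.
  apply: le_trans (XY v); rewrite ler_piMl//; last by lra.
  by rewrite qformZ mulr_ge0 ?posdef_qform_ge0//; lra.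
by move=> [AB BA]; split; exact: sqrt_le.
Qed.

Inductive chain (th : R) : M -> M -> R -> Prop :=
| chain_nil A : posdef A -> chain th A A 0
| chain_cons A B D r : posdef A -> nearby th A B -> chain th B D r ->
    chain th A D (relnorm A B + r).

Lemma chain_posdef th A B r : chain th A B r -> posdef A /\ posdef B.
Proof.
elim=> [{}A pA|{}A B' D {}r pA _ _ [_ pD]]; first exact: (conj pA pA).
exact: (conj pA pD).
Qed.

Lemma chain_cat th A B D r s : chain th A B r -> chain th B D s ->
  chain th A D (r + s).
Proof.
elim=> [{}A pA|{}A B' {}B {}r pA AB _ IH /IH h]; first by rewrite add0r.
by rewrite -addrA; exact: chain_cons.
Qed.

(** A chain carries no parametrization, so f acts on its points and needs no regularity beyond
    respecting [nearby]. *)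
Lemma chain_map th (f : M -> M) (c : R) A B r : 0 <= c ->
  (forall X, posdef X -> posdef (f X)) ->
  (forall X Y, posdef X -> posdef Y -> nearby th X Y -> nearby th (f X) (f Y)) ->
  (forall X Y, posdef X -> posdef Y -> relnorm (f X) (f Y) <= c * relnorm X Y) ->
  chain th A B r -> exists2 s, s <= c * r & chain th (f A) (f B) s.
Proof.
move=> c0 pf nf rf; elim=> [{}A pA|{}A B' {}B {}r pA AB ch [s sr IH]].
  by exists 0; rewrite ?mulr0//; exact/chain_nil/pf.
have [pB' _] := chain_posdef ch.
exists (relnorm (f A) (f B') + s); first by rewrite mulrDr lerD// rf.
exact: (chain_cons (pf _ pA) (nf _ _ pA pB' AB) IH).
Qed.

End RelativeNorm.

(** * From chains to curves *)

Section Integrals.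
Context {R : realType}.
Local Notation mu := (@lebesgue_measure R).

(* The integral of a nonnegative function is a supremum over the simple
   functions below it, so no measurability is needed here. *)
Lemma ge0_le_integral_nomeas (D : set R) (f g : R -> \bar R) :
  (forall x, D x -> (0 <= f x)%E) -> (forall x, D x -> (f x <= g x)%E) ->
  (\int[mu]_(x in D) f x <= \int[mu]_(x in D) g x)%E.
Proof.
move=> f0 fg; rewrite !ge0_integralE//; last first.
  by move=> x Dx; apply: le_trans (fg x Dx); exact: f0.
apply: ereal_sup_le => _ /= [h hf <-]; exists h => // x.
apply: le_trans (hf x) _; rewrite /patch; case: ifP => //.
by rewrite inE; exact: fg.
Qed.

Lemma integral_step_le (D : set R) (I : finType) (c l : I -> R) (E : I -> set R) :
  measurable D -> (forall i, measurable (E i)) -> (forall i, 0 <= c i) ->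
  (forall i, mu (E i) = (l i)%:E) ->
  (\int[mu]_(x in D) (\sum_i c i * \1_(E i) x)%:E <= (\sum_i c i * l i)%:E)%E.
Proof.
move=> mD mE c0 El.
under eq_integral do rewrite -sumEFin.
have m1 i : measurable_fun D (EFin \o (\1_(E i) : R -> R)) by exact/measurable_EFinP.
have m2 i : measurable_fun D (fun x => (c i * \1_(E i) x)%:E).
  exact/measurable_EFinP/measurable_funM.
have p2 i x : D x -> (0 <= (c i * \1_(E i) x)%:E)%E by rewrite lee_fin mulr_ge0.
rewrite (ge0_integral_sum mu mD m2 p2) -sumEFin; apply: lee_sum => i _.
under eq_integral do rewrite EFinM.
rewrite (ge0_integralZl_EFin mu mD _ (m1 i))//.
  rewrite EFinM lee_wpmul2l ?lee_fin//.
  have -> : (\int[mu]_(x in D) (EFin \o \1_(E i)) x = mu (E i `&` D))%E.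
    exact (integral_indic mu mD (mE i)).
  rewrite -El; apply: le_measure; rewrite ?inE; [|exact: mE|exact: subIsetl].
  exact (measurableI _ _ (mE i) mD).
by move=> x _; rewrite lee_fin.
Qed.

(** Overlaps of the E_i and their parts outside D only increase the right-hand side, so any finite
    cover with known measures serves. The bound on the extended integral also shows that it is
    finite, which is what lets it pass through [fine]. *)
Lemma Rintegral_le_step (D : set R) (F : R -> R) (I : finType) (c l : I -> R)
    (E : I -> set R) :
  measurable D -> (forall x, D x -> 0 <= F x) ->
  (forall i, measurable (E i)) -> (forall i, 0 <= c i) ->
  (forall i, mu (E i) = (l i)%:E) ->
  (forall x, D x -> exists2 i, E i x & F x <= c i) ->
  \int[mu]_(x in D) F x <= \sum_i c i * l i.
Proof.
move=> mD F0 mE c0 El FE.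
have h : (\int[mu]_(x in D) (F x)%:E <= (\sum_i c i * l i)%:E)%E.
  apply: le_trans (integral_step_le mD mE c0 El).
  apply: ge0_le_integral_nomeas => x Dx; first by rewrite lee_fin F0.
  have [i Eix Fc] := FE x Dx; rewrite lee_fin (bigD1 i)//=.
  rewrite (le_trans Fc)// indicE mem_set//= mulr1 lerDl.
  by apply: sumr_ge0 => j _; rewrite mulr_ge0.
have h0 : (0 <= \int[mu]_(x in D) (F x)%:E)%E by apply: integral_ge0 => x Dx; rewrite lee_fin F0.
rewrite /Rintegral -lee_fin fineK// fin_numElt (lt_le_trans _ h0)//=.
by apply: le_lt_trans h _; rewrite ltry.
Qed.

End Integrals.

(** * Piecewise affine curves through a sequence of matrices *)

Section Polygons.
Context {R : realType} {n : nat}.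
Local Notation C := R[i].
Local Notation M := 'M[C]_n.
Implicit Types (A B X Y : M).

Lemma is_derive_affine (p q x : R) : is_derive x (1 : R) (fun t : R => p + q * t) q.
Proof.
have := is_deriveD (is_derive_cst p x (1 : R)) (is_deriveZ q (is_derive_id x (1 : R))).
by rewrite add0r [_ *: 1]mulr1.
Qed.

Lemma derive1_affine (p q x : R) : derive1 (fun t => p + q * t) x = q.
Proof. by rewrite derive1E; have [_ ->] := is_derive_affine p q x. Qed.

Lemma smooth_affine (p q : R) : smooth (fun t => p + q * t).
Proof.
move=> k; elim: k p q => [|k IH] p q x.
  by case: (is_derive_affine p q x).
rewrite /derive1n iterSr -/(derive1n k _).
have -> : derive1 (fun t => p + q * t) = (fun t => q + 0 * t).
  by apply/funext => t; rewrite mul0r addr0 derive1_affine.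
exact: IH.
Qed.

Lemma near_eq_derive1 (f g : R -> R) (x : R) :
  {near x, f =1 g} -> derive1 f x = derive1 g x.
Proof. by move=> fg; rewrite !derive1E; exact: near_eq_derive. Qed.

Lemma velocity_near_eq (a b : R -> M) (x : R) :
  {near x, a =1 b} -> velocity a x = velocity b x.
Proof.
move=> ab; apply/matrixP => i j; rewrite !mxE.
by congr (_ +i* _); apply: near_eq_derive1; apply: filterS ab => y ->.
Qed.

(** With c = k and m pieces in all, the segment is traversed on [k/m, (k+1)/m]. Every piece uses the
    global time of the polygon, at constant velocity m (Y - X). *)
Definition segm (X Y : M) (c m : R) (t : R) : M := X + (m * t - c)%:C *: (Y - X).

Lemma segm_ReIm X Y c m t i j :
  complex.Re (segm X Y c m t i j) =
    (complex.Re (X i j) - c * complex.Re ((Y - X) i j))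
      + (m * complex.Re ((Y - X) i j)) * t /\
  complex.Im (segm X Y c m t i j) =
    (complex.Im (X i j) - c * complex.Im ((Y - X) i j))
      + (m * complex.Im ((Y - X) i j)) * t.
Proof.
rewrite /segm mxE mxE; case: (X i j) ((Y - X) i j) => x y [z w] /=.
by split; ring.
Qed.

Lemma segm_smooth X Y c m : mxsmooth (segm X Y c m).
Proof.
move=> i j; split.
  under [X in smooth X]eq_fun do rewrite (segm_ReIm _ _ _ _ _ _ _).1.
  exact: smooth_affine.
under [X in smooth X]eq_fun do rewrite (segm_ReIm _ _ _ _ _ _ _).2.
exact: smooth_affine.
Qed.

Lemma velocity_segm X Y c m t : velocity (segm X Y c m) t = m%:C *: (Y - X).
Proof.
apply/matrixP => i j; rewrite [LHS]mxE [RHS]mxE.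
have -> : (fun u => complex.Re (segm X Y c m u i j)) =
  (fun u => (complex.Re (X i j) - c * complex.Re ((Y - X) i j))
      + (m * complex.Re ((Y - X) i j)) * u).
  by apply/funext => u; rewrite (segm_ReIm _ _ _ _ _ _ _).1.
have -> : (fun u => complex.Im (segm X Y c m u i j)) =
  (fun u => (complex.Im (X i j) - c * complex.Im ((Y - X) i j))
      + (m * complex.Im ((Y - X) i j)) * u).
  by apply/funext => u; rewrite (segm_ReIm _ _ _ _ _ _ _).2.
rewrite !derive1_affine; case: ((Y - X) i j) => x y.
by apply/eqP; rewrite eq_complex /= !mul0r subr0 addr0 !eqxx.
Qed.

Lemma qform_segm X Y c m t v :
  qform (segm X Y c m t) v = (1 - (m * t - c)) * qform X v + (m * t - c) * qform Y v.
Proof. by rewrite /segm qformD qformZ qformB; ring. Qed.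

Lemma segm_posdef X Y c m t : posdef X -> posdef Y -> 0 <= m * t - c <= 1 ->
  posdef (segm X Y c m t).
Proof.
move=> /posdefP[hX pX] /posdefP[hY pY] /andP[t0 t1]; apply/posdefP; split.
  by rewrite /segm adjD adjZ adjB hX hY; congr (_ + _ *: _); exact: conjc_real.
move=> v v0; rewrite qform_segm; have := pX v v0; have := pY v v0.
move: (qform X v) (qform Y v) (m * t - c) t0 t1 => x y s; nra.
Qed.

Definition polygon (x : nat -> M) (m : nat) (t : R) : M :=
  let k := Num.truncn (m%:R * t) in segm (x k) (x k.+1) k%:R m%:R t.

(** At the right end t = (k+1)/m the truncation already selects the next segment, but the two
    segments meet there. This gives the closed pieces that [piecewise_smooth] asks for. *)
Lemma polygon_segm (x : nat -> M) (m k : nat) (t : R) : (0 < m)%N ->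
  k%:R <= m%:R * t <= k.+1%:R -> polygon x m t = segm (x k) (x k.+1) k%:R m%:R t.
Proof.
move=> m0 /andP[k1]; rewrite le_eqVlt => /predU1P[k2|k2]; last first.
  by rewrite /polygon (@truncn_def _ _ k)// k1.
have e : k.+1%:R - k%:R = 1 :> R by rewrite -natr1 addrAC subrr add0r.
by rewrite /polygon k2 natrK /segm k2 subrr scale0r addr0 e scale1r subrKC.
Qed.

End Polygons.

(** * The distance is bounded by the sums along chains *)

Section UpperBound.
Context {R : realType} {n : nat}.
Local Notation C := R[i].
Local Notation M := 'M[C]_n.
Implicit Types (A B X Y Z W V : M).
Variable N : M -> R.
Hypothesis hN : unitarily_invariant_norm N.

Definition whitened (Z V W : M) : R :=
  N (mxpowR Z (- 2^-1) *m V *m mxpowR W (- 2^-1)).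

(** The left and the right whitening each cost sqrt(1/c). *)
Lemma whitened_loewner X Y Z W V (c : R) : 0 < c ->
  posdef X -> posdef Y -> posdef Z -> posdef W ->
  loewner (c%:C *: X) Z -> loewner (c%:C *: Y) W ->
  whitened Z V W <= c^-1 * whitened X V Y.
Proof.
move=> c0 pX pY pZ pW XZ YW; rewrite /whitened.
have hX := mxpowR_whiten pX; have hY := mxpowR_whiten pY.
have hZ := mxpowR_whiten pZ; have hW := mxpowR_whiten pW.
rewrite -{1}(mxpowR_adj _ pW) -{1}(mxpowR_adj _ pY); move: hX hY hZ hW.
move: (mxpowR X _) (mxpowR Y _) (mxpowR Z _) (mxpowR W _) => SX SY SZ SW hX hY hZ hW.
apply: le_trans (uinorm_loewnerr hN _ pY c0 YW hY hW) _.
have e : c^-1 = Num.sqrt c^-1 * Num.sqrt c^-1.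
  by rewrite -expr2 sqr_sqrtr// invr_ge0 ltW.
rewrite [in X in _ <= X * _]e -mulrA; apply: ler_wpM2l; first exact: sqrtr_ge0.
rewrite -(mulmxA SZ) -(mulmxA SX).
exact: (uinorm_loewnerl hN _ pX c0 XZ hX hZ).
Qed.

Lemma relnorm_refl A : relnorm N A A = 0.
Proof. by rewrite /relnorm subrr mulmx0 mul0mx (uinorm0 hN). Qed.

Lemma nearby_refl th A : 0 <= th -> posdef A -> nearby th A A.
Proof.
by move=> th0 pA; split=> v; rewrite qformZ ler_piMl ?posdef_qform_ge0//; lra.
Qed.

Lemma chain_seq th A B r : 0 <= th -> chain N th A B r ->
  exists (x : nat -> M) m, [/\ (0 < m)%N, x 0 = A, x m = B,
   forall k, posdef (x k) & (forall k, (k < m)%N -> nearby th (x k) (x k.+1)) /\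
     r = \sum_(k < m) relnorm N (x k) (x k.+1)].
Proof.
move=> th0; elim=> [{}A pA|{}A B' {}B {}r pA AB _ [x [m [m0 x0 xm px [nx ->]]]]].
  (* The empty chain becomes one constant step, since the polygon is parametrized with m > 0. *)
  exists (fun=> A), 1%N; split=> //; split; last by rewrite big_ord1 relnorm_refl.
  by move=> k _; exact: nearby_refl.
exists (fun k => if k is k'.+1 then x k' else A), m.+1; split.
- exact: ltn0Sn.
- by [].
- exact: xm.
- by case=> [|k]; [exact: pA|exact: px].
- split; last by rewrite big_ord_recl /= x0.
  by case=> [_|k]; [rewrite x0|exact: nx].
Qed.

Definition speed (a : R -> M) (t : R) : R := whitened (a t) (velocity a t) (a t).

Lemma speed_ge0 a t : 0 <= speed a t.
Proof. exact: uinorm_ge0 hN _. Qed.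

Lemma polygon_joining (x : nat -> M) m : (0 < m)%N -> (forall k, posdef (x k)) ->
  joining_curve (x 0) (x m) (polygon x m).
Proof.
move=> m0 px; have mR : (0 : R) < m%:R by rewrite ltr0n.
pose f k : R := k%:R / m%:R.
have f0 : f 0 = 0 by rewrite /f mul0r.
split.
- exists [seq f k | k <- iota 1 m].
    split; last first.
      rewrite -f0 last_map -nth_last size_iota nth_iota ?prednK// add1n prednK//.
      by rewrite /f divff// gt_eqF.
    rewrite -f0 path_map; have := iota_ltn_sorted 0 m.+1; rewrite /=.
    apply: sub_path => i j ij; rewrite /relpre /f /=.
    by rewrite ltr_pM2r ?invr_gt0// ltr_nat.
  move=> i; rewrite size_map size_iota => im.
  exists (segm (x i) (x i.+1) i%:R m%:R); first exact: segm_smooth.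
  have nthf p q : (q < m.+1)%N -> nth 0 [seq f k | k <- iota p m.+1] q = f (p + q)%N.
    by move=> qm; rewrite (nth_map 0%N) ?size_iota// nth_iota.
  have nth0 : nth 0 (0 :: [seq f k | k <- iota 1 m]) i = f i.
    by rewrite -{2}f0; apply: (nthf 0%N); exact: ltnW.
  have nth1 : nth 0 [seq f k | k <- iota 1 m] i = f i.+1.
    by rewrite (nth_map 0%N) ?size_iota// nth_iota.
  rewrite nth0 nth1 => t; rewrite in_itv /= => /andP[t1 t2].
  apply: (polygon_segm x m0); apply/andP; split.
    by move: t1; rewrite /f (ler_pdivrMr _ _ mR) (mulrC t).
  by move: t2; rewrite /f (ler_pdivlMr _ _ mR) (mulrC t).
- move=> t; rewrite in_itv /= => /andP[t0 t1]; rewrite /polygon.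
  have /andP[k1 k2] : (Num.truncn (m%:R * t))%:R <= m%:R * t < (Num.truncn (m%:R * t)).+1%:R.
    by apply: truncn_itv; rewrite mulr_ge0.
  by apply: segm_posdef => //; move: k1 k2; rewrite -natr1; lra.
- rewrite /polygon mulr0 truncn0 /segm mulr0 subrr scale0r addr0//.
- by rewrite /polygon mulr1 natrK /segm mulr1 subrr scale0r addr0.
Qed.

Lemma joining_curve_exists A B : posdef A -> posdef B ->
  exists a, joining_curve A B a.
Proof.
move=> pA pB; pose x k := if k is 0%N then A else B.
have px k : posdef (x k) by case: k => [|k]; [exact: pA|exact: pB].
by exists (polygon x 1); exact: (polygon_joining (ltn0Sn 0) px).
Qed.

(** Each of X and Y dominates 1 - th times the other, hence every point of the segment dominates
    both (1 - th) X and (1 - th) Y. So whitening m (Y - X) at that point costs at most 1 / (1 - th)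
    more than whitening by X on the left and Y on the right, as in [relnorm]. *)
Lemma speed_polygon th (x : nat -> M) m k t : 0 < th < 1 -> (0 < m)%N ->
  (forall k, posdef (x k)) -> nearby th (x k) (x k.+1) ->
  k%:R / m%:R < t < k.+1%:R / m%:R ->
  speed (polygon x m) t <= m%:R / (1 - th) * relnorm N (x k) (x k.+1).
Proof.
move=> /andP[th0 th1] m0 px [XY YX] kt; have mR : (0 : R) < m%:R by rewrite ltr0n.
set X := x k in XY YX *; set Y := x k.+1 in XY YX *.
have km (s : R) : s \in `]k%:R / m%:R, k.+1%:R / m%:R[ -> k%:R <= m%:R * s <= k.+1%:R.
  rewrite in_itv /= => /andP[/ltW s1 /ltW s2]; apply/andP; split.
    by move: s1; rewrite (ler_pdivrMr _ _ mR) (mulrC s).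
  by move: s2; rewrite (ler_pdivlMr _ _ mR) (mulrC s).
have tk : t \in `]k%:R / m%:R, k.+1%:R / m%:R[ by rewrite in_itv.
have near_segm : {near t, polygon x m =1 segm X Y k%:R m%:R}.
  near=> s; apply: polygon_segm => //; apply: km.
  by near: s; exact: near_in_itvoo.
rewrite /speed (velocity_near_eq near_segm) velocity_segm (polygon_segm x m0 (km _ tk)).
rewrite -/X -/Y.
have /andP[s0 s1] : 0 <= m%:R * t - k%:R <= 1 by have := km _ tk; rewrite -natr1; lra.
have pS : posdef (segm X Y k%:R m%:R t) by apply: (segm_posdef (px k) (px k.+1)); apply/andP.
have wZ W : whitened W (m%:R%:C *: (Y - X)) W = m%:R * whitened W (Y - X) W.
  by rewrite /whitened -scalemxAr -scalemxAl (uinormZ hN) ger0_norm ?ler0n.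
rewrite wZ -mulrA ler_wpM2l ?ler0n//.
have convex_ge (c p q s : R) : 0 <= s -> s <= 1 -> c <= p -> c <= q ->
    c <= (1 - s) * p + s * q by move=> *; nra.
have shrink v Z : posdef Z -> (1 - th) * qform Z v <= qform Z v.
  by move=> pZ; rewrite ler_piMl ?posdef_qform_ge0//; lra.
apply: (whitened_loewner _ _ (px k) (px k.+1) pS pS); first by lra.
  move=> v; rewrite qformZ qform_segm; apply: convex_ge => //.
    exact: shrink (px k).
  by have := XY v; rewrite qformZ.
move=> v; rewrite qformZ qform_segm; apply: convex_ge => //.
  by have := YX v; rewrite qformZ.
exact: shrink (px k.+1).
Unshelve. all: by end_near. Qed.

Lemma curve_length_ge0 a : 0 <= curve_length N a.
Proof. by apply: Rintegral_ge0 => t _; exact: speed_ge0. Qed.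

Lemma dist_le_length A B a : joining_curve A B a -> dist N A B <= curve_length N a.
Proof.
move=> ja; apply: ge_inf; last by exists a.
by exists 0 => _ [b _ <-]; exact: curve_length_ge0.
Qed.

Lemma dist_le_chain th A B r : 0 < th < 1 -> chain N th A B r ->
  dist N A B <= r / (1 - th).
Proof.
move=> th01; have /andP[th0 th1] := th01.
move=> /(chain_seq (ltW th0))[x [m [m0 <- <- px [nx ->]]]].
apply: le_trans (dist_le_length (polygon_joining m0 px)) _.
have mR : (0 : R) < m%:R by rewrite ltr0n.
pose F := speed (polygon x m).
(* The open intervals carry the bound of [speed_polygon]. At the vertices k/m the polygon may fail
   to be differentiable, so there [c] is the speed itself, whatever it is, on a singleton of length
   0. *)
pose c (i : 'I_m + 'I_m.+1) : R := match i with
  | inl k => m%:R / (1 - th) * relnorm N (x k) (x k.+1)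
  | inr k => F (k%:R / m%:R) end.
pose E (i : 'I_m + 'I_m.+1) : set R := match i with
  | inl k => `]k%:R / m%:R, k.+1%:R / m%:R[%classic
  | inr k => [set k%:R / m%:R] end.
pose l (i : 'I_m + 'I_m.+1) : R := match i with inl k => m%:R^-1 | inr k => 0 end.
have -> : (\sum_(k < m) relnorm N (x k) (x k.+1)) / (1 - th) = \sum_i c i * l i.
  rewrite big_sumType /= [X in _ = _ + X]big1 ?addr0 => [|k _]; last by rewrite mulr0.
  rewrite mulr_suml; apply: eq_bigr => k _; field; rewrite gt_eqF//=; lra.
apply: (@Rintegral_le_step _ _ _ _ c l E) => //.
- by move=> t _; exact: speed_ge0.
- by case=> k; [exact: measurable_itv|exact: measurable_set1].
- case=> k; last exact: speed_ge0.
  by rewrite mulr_ge0 ?relnorm_ge0// divr_ge0 ?ler0n//; lra.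
- case=> k /=; last exact: lebesgue_measure_set1.
  rewrite lebesgue_measure_itv /= lte_fin ltr_pM2r ?invr_gt0// ltr_nat ltnSn.
  by rewrite -EFinD -mulrBl -natr1 addrAC subrr add0r mul1r.
- move=> t; rewrite /= in_itv /= => /andP[t0 t1].
  pose k := Num.truncn (m%:R * t).
  have /andP[k1 k2] : k%:R <= m%:R * t < k.+1%:R by apply: truncn_itv; rewrite mulr_ge0.
  have km : (k <= m)%N.
    by rewrite -(ler_nat R) (le_trans k1)// -[leRHS]mulr1 ler_pM2l.
  have [kt|/eqP kt] := eqVneq t (k%:R / m%:R).
    by exists (inr (Ordinal (km : (k < m.+1)%N))) => /=; rewrite ?kt.
  have km' : (k < m)%N.
    rewrite ltn_neqAle km andbT; apply/eqP => kE; apply: kt.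
    apply/eqP; rewrite eq_le kE divff ?gt_eqF// t1 /=.
    by rewrite -(ler_pM2l mR) mulr1 -{1}kE.
  have tk : k%:R / m%:R < t < k.+1%:R / m%:R.
    rewrite ltr_pdivlMr// (mulrC t) k2 andbT lt_neqAle ler_pdivrMr// (mulrC t) k1 andbT.
    by apply/eqP => /esym.
  exists (inl (Ordinal km')) => /=; first by rewrite in_itv.
  exact: speed_polygon (nx _ _) tk.
Qed.

End UpperBound.

(** * From curves to chains *)

Section SmoothBounds.
Context {R : realType}.

Lemma smooth_derivable (f : R -> R) (x : R) : smooth f -> derivable f x 1.
Proof. by move=> /(_ 0%N x). Qed.

Lemma smooth_derive1 (f : R -> R) : smooth f -> smooth (derive1 f).
Proof. by move=> sf k x; have := sf k.+1 x; rewrite /derive1n iterSr. Qed.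

Lemma smooth_bounded (f : R -> R) (c d : R) : smooth f -> c <= d ->
  exists2 K, 0 <= K & forall x, c <= x <= d -> `|f x| <= K.
Proof.
move=> sf cd.
have cf : {within `[c, d], continuous f}.
  by apply: derivable_within_continuous => x _; exact: smooth_derivable.
have [p _ hp] := EVT_max cd cf; have [q _ hq] := EVT_min cd cf.
exists (`|f p| + `|f q|); first by rewrite addr_ge0.
move=> x xcd; have x_in : x \in `[c, d] by rewrite in_itv.
have := hp x x_in; have := hq x x_in; have := ler_norm (f p); have := ler_norm (- f q).
rewrite normrN => h1 h2 h3 h4; rewrite ler_norml; apply/andP; split.
  by have := normr_ge0 (f p); lra.
by have := normr_ge0 (f q); lra.
Qed.

Lemma smooth_MVT (f : R -> R) (u v : R) : smooth f -> u <= v ->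
  exists2 z, u <= z <= v & f v - f u = derive1 f z * (v - u).
Proof.
move=> sf uv.
have df z : z \in `]u, v[ -> is_derive z (1 : R) f (derive1 f z).
  by move=> _; apply: DeriveDef; [exact: smooth_derivable|rewrite derive1E].
have cf : {within `[u, v], continuous f}.
  by apply: derivable_within_continuous => x _; exact: smooth_derivable.
have [z z_in ->] := MVT_segment uv df cf.
by exists z => //; move: z_in; rewrite in_itv.
Qed.

(** The increment is compared with the derivative at an arbitrary t of [u, v], because a step of the
    chain has to bound the speed from below on the whole step. Two mean value arguments give this,
    with bounds on f' and f''. *)
Lemma smooth_estimate (f : R -> R) (c d : R) : smooth f -> c <= d -> exists2 K, 0 <= K &
  forall u t v, c <= u -> u <= t -> t <= v -> v <= d ->
  [/\ `|f v - f u - (v - u) * derive1 f t| <= K * (v - u) ^+ 2,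
      `|derive1 f t| <= K & `|f v - f u| <= K * (v - u)].
Proof.
move=> sf cd; have sf' := smooth_derive1 sf; have sf'' := smooth_derive1 sf'.
have [K1 K1_ge0 hK1] := smooth_bounded sf' cd.
have [K2 K2_ge0 hK2] := smooth_bounded sf'' cd.
exists (K1 + K2) => [|u t v cu ut tv vd]; first exact: addr_ge0.
have uv := le_trans ut tv.
have [z /andP[uz zv] fE] := smooth_MVT sf uv.
have zt : `|derive1 f z - derive1 f t| <= K2 * (v - u).
  have bound p q : u <= p -> p <= q -> q <= v ->
      `|derive1 f q - derive1 f p| <= K2 * (v - u).
    move=> up pq qv; have [w /andP[pw wq] ->] := smooth_MVT sf' pq.
    rewrite normrM [`|q - p|]ger0_norm ?subr_ge0//.
    apply: ler_pM => //; [by rewrite subr_ge0|apply: hK2|lra].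
    by apply/andP; split; lra.
  by case: (leP t z) => [|/ltW] tz; [|rewrite distrC]; exact: bound.
split.
- rewrite fE mulrC -mulrBr normrM ger0_norm ?subr_ge0// expr2 mulrCA.
  apply: ler_wpM2l; first by rewrite subr_ge0.
  by apply: le_trans zt _; rewrite ler_wpM2r ?subr_ge0// lerDr.
- by apply: le_trans (hK1 t _) _; [apply/andP; split; lra|rewrite lerDl].
- rewrite fE normrM [`|v - u|]ger0_norm ?subr_ge0// ler_wpM2r ?subr_ge0//.
  by apply: le_trans (hK1 z _) _; [apply/andP; split; lra|rewrite lerDl].
Qed.

Lemma normc_le (z : R[i]) : Normc.normc z <= `|complex.Re z| + `|complex.Im z|.
Proof.
case: z => x y /=; rewrite -[leRHS]ger0_norm ?addr_ge0// -sqrtr_sqr ler_wsqrtr//.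
by rewrite sqrrD !real_normK ?num_real// lerD2r lerDl mulrn_wge0 ?mulr_ge0.
Qed.

Lemma mxsmooth_estimate n (b : R -> 'M[R[i]]_n) (c d : R) : mxsmooth b -> c <= d ->
  exists2 K, 0 <= K & forall u t v, c <= u -> u <= t -> t <= v -> v <= d ->
  forall i j,
  [/\ Normc.normc ((b v - b u - (v - u)%:C *: velocity b t) i j) <= K * (v - u) ^+ 2,
      Normc.normc (velocity b t i j) <= K
    & Normc.normc ((b v - b u) i j) <= K * (v - u)].
Proof.
move=> sb cd.
have /choice[K hK] (p : 'I_n * 'I_n) : exists K : R, 0 <= K /\
   forall u t v, c <= u -> u <= t -> t <= v -> v <= d ->
  [/\ Normc.normc ((b v - b u - (v - u)%:C *: velocity b t) p.1 p.2) <= K * (v - u) ^+ 2,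
      Normc.normc (velocity b t p.1 p.2) <= K
    & Normc.normc ((b v - b u) p.1 p.2) <= K * (v - u)].
  case: p => i j /=; have [sRe sIm] := sb i j.
  have [K1 K1_ge0 h1] := smooth_estimate sRe cd.
  have [K2 K2_ge0 h2] := smooth_estimate sIm cd.
  exists (K1 + K2); split=> [|u t v cu ut tv vd]; first exact: addr_ge0.
  have [p1 p2 p3] := h1 u t v cu ut tv vd; have [q1 q2 q3] := h2 u t v cu ut tv vd.
  split; (apply: le_trans (normc_le _) _; rewrite ?[in leRHS]mulrDl; apply: lerD).
  - apply: le_trans p1; rewrite !mxE.
    by case: (b v i j) (b u i j) => x1 y1 [x2 y2] /=; rewrite mul0r subr0.
  - apply: le_trans q1; rewrite !mxE.
    by case: (b v i j) (b u i j) => x1 y1 [x2 y2] /=; rewrite mul0r addr0.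
  - by rewrite mxE.
  - by rewrite mxE.
  - by apply: le_trans p3; rewrite !mxE; case: (b v i j) (b u i j) => x1 y1 [x2 y2].
  - by apply: le_trans q3; rewrite !mxE; case: (b v i j) (b u i j) => x1 y1 [x2 y2].
have K_le i j : K (i, j) <= \sum_p K p.
  by rewrite (bigD1 (i, j))//= lerDl sumr_ge0// => p _; case: (hK p).
exists (\sum_p K p); first by apply: sumr_ge0 => p _; case: (hK p).
move=> u t v cu ut tv vd i j.
have [_ /(_ u t v cu ut tv vd)[p1 p2 p3]] := hK (i, j).
split; [apply: le_trans p1 _|apply: le_trans p2 _|apply: le_trans p3 _] => //.
  by rewrite ler_wpM2r ?sqr_ge0.
by rewrite ler_wpM2r ?subr_ge0// (le_trans ut).
Qed.

Lemma qform_bound n (E : 'M[R[i]]_n) v :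
  `|qform E v| <= (\sum_i \sum_j Normc.normc (E i j)) * qform 1%:M v.
Proof.
have q1 : qform 1%:M v = \sum_i Normc.normc (v 0 i) ^+ 2.
  by rewrite -rdiag1 qform_rdiag; apply: eq_bigr => i _; rewrite mxE mul1r.
have le1 i : Normc.normc (v 0 i) ^+ 2 <= qform 1%:M v.
  by rewrite q1 (bigD1 i)//= lerDl sumr_ge0// => j _; exact: sqr_ge0.
have n0 (z : R[i]) : 0 <= Normc.normc z by case: z => x y; exact: sqrtr_ge0.
have Re_le (z : R[i]) : `|complex.Re z| <= Normc.normc z.
  by case: z => x y /=; rewrite -sqrtr_sqr ler_wsqrtr// lerDl sqr_ge0.
have -> : qform E v = \sum_i \sum_j complex.Re (v 0 i * E i j * conjc (v 0 j)).
  rewrite /qform mxE raddf_sum exchange_big /=; apply: eq_bigr => j _.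
  rewrite !mxE mulr_suml raddf_sum; by apply: eq_bigr => i _.
apply: le_trans (ler_norm_sum _ _ _) _; rewrite mulr_suml; apply: ler_sum => i _.
apply: le_trans (ler_norm_sum _ _ _) _; rewrite mulr_suml; apply: ler_sum => j _.
apply: le_trans (Re_le _) _; rewrite !Normc.normcM.
have -> : Normc.normc (conjc (v 0 j)) = Normc.normc (v 0 j).
  by case: (v 0 j) => x y /=; rewrite sqrrN.
rewrite mulrAC mulrC ler_wpM2l//.
have := le1 i; have := le1 j; have := n0 (v 0 i); have := n0 (v 0 j).
by move: (Normc.normc _) (Normc.normc _) => x y; nra.
Qed.

End SmoothBounds.

(** * Uniform estimates along a smooth piece *)

Section SmoothPiece.
Context {R : realType} {n : nat}.
Local Notation C := R[i].
Local Notation M := 'M[C]_n.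
Implicit Types (A B X Y Z W V : M).

Lemma posdef_lower_bound A : posdef A ->
  exists2 m : R, 0 < m & loewner (m%:C *: 1%:M) A.
Proof.
move=> /posdef_spectral[U [d [uU d0 -> _]]].
have s0 : 0 < \sum_i (d 0 i)^-1 + 1.
  by rewrite ltr_wpDl// sumr_ge0// => i _; rewrite invr_ge0 ltW.
(* A number below every eigenvalue without taking a minimum; the 1 keeps it defined and positive
   when n = 0. *)
exists (\sum_i (d 0 i)^-1 + 1)^-1; first by rewrite invr_gt0.
have md i : (\sum_i (d 0 i)^-1 + 1)^-1 <= d 0 i.
  rewrite -[leRHS]invrK lef_pV2 ?posrE ?invr_gt0//.
  rewrite (bigD1 i)//= -addrA lerDl addr_ge0// sumr_ge0// => j _.
  by rewrite invr_ge0 ltW.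
rewrite -(unitary_rdiag1 uU); apply: (loewner_unitary uU) => i.
by rewrite mxE mulr1; exact: md.
Qed.

Lemma sum_entries_le (E : M) (k : R) : (forall i j, Normc.normc (E i j) <= k) ->
  \sum_i \sum_j Normc.normc (E i j) <= k * \sum_(i < n) \sum_(j < n) 1.
Proof.
move=> Ek; rewrite mulr_sumr; apply: ler_sum => i _; rewrite mulr_sumr.
by apply: ler_sum => j _; rewrite mulr1.
Qed.

Lemma qform1_ge0 (v : 'rV[C]_n) : 0 <= qform 1%:M v.
Proof. exact: posdef_qform_ge0 (@posdef1 R n). Qed.

(** Compactness: b is Lipschitz, so a lower bound m0 at x leaves every m < m0/2 as a lower bound
    near x. The near-covering form of compactness with the filter of small positive m replaces a
    finite minimum. *)
Lemma mxsmooth_lower_bound (b : R -> M) (c d : R) : mxsmooth b -> c <= d ->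
  (forall t, c <= t <= d -> posdef (b t)) ->
  exists2 m : R, 0 < m & forall t, c <= t <= d -> loewner (m%:C *: 1%:M) (b t).
Proof.
move=> sb cd pb; have [K K0 hK] := mxsmooth_estimate sb cd.
pose nn : R := \sum_(i < n) \sum_(j < n) 1.
have nn0 : 0 <= nn by rewrite sumr_ge0// => i _; rewrite sumr_ge0.
have lip x y v : c <= x <= d -> c <= y <= d ->
    qform (b x) v - qform (b y) v <= K * nn * `|x - y| * qform 1%:M v.
  have lip' p q : c <= p -> p <= q -> q <= d ->
      `|qform (b q) v - qform (b p) v| <= K * nn * (q - p) * qform 1%:M v.
    move=> cp pq qd; rewrite -qformB; apply: le_trans (qform_bound _ _) _.
    rewrite ler_wpM2r ?qform1_ge0// mulrAC; apply: sum_entries_le => i j.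
    by have [] := hK p p q cp (lexx p) pq qd i j.
  move=> /andP[cx xd] /andP[cy yd]; case: (leP x y) => [xy|/ltW yx].
    apply: le_trans (ler_norm _) _; rewrite distrC (distrC x) [`|y - x|]ger0_norm ?subr_ge0//.
    exact: lip'.
  apply: le_trans (ler_norm _) _; rewrite [`|x - y|]ger0_norm ?subr_ge0//.
  exact: lip'.
have /compact_near_coveringP/near_covering_withinP cov := @segment_compact R c d.
have : \forall m \near 0^'+, `[c, d] `<=` [set t | loewner (m%:C *: 1%:M) (b t)].
  apply: (cov R 0^'+ (fun m t => loewner (m%:C *: 1%:M) (b t))) => x /=.
  rewrite in_itv /= => xcd; have [m0 m00 hm0] := posdef_lower_bound (pb x xcd).
  (* Within distance e of x the Lipschitz bound lets the form drop by at most m0/2; the 1 keeps the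
     denominator positive. *)
  pose e := m0 / 2 / (K * nn + 1).
  have Kn : 0 < K * nn + 1 by rewrite ltr_wpDl// mulr_ge0.
  have e0 : 0 < e by rewrite !divr_gt0.
  exists ([set y | `|x - y| < e], [set m | m < m0 / 2]) => /=.
    split; first by exists e.
    by apply: nbhs_right_lt; rewrite divr_gt0.
  move=> [y m] /= [ye mm0]; rewrite in_itv /= => ycd v; rewrite qformZ.
  have := hm0 v; rewrite qformZ => h0.
  have h1 := lip x y v xcd ycd; have q0 := qform1_ge0 v.
  have h2 : K * nn * `|x - y| <= m0 / 2.
    rewrite (@le_trans _ _ ((K * nn + 1) * e))//; last first.
      by rewrite /e mulrC divfK ?gt_eqF.
    apply: ler_pM => //; [by rewrite mulr_ge0|by rewrite lerDl|exact: ltW].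
  have h3 : K * nn * `|x - y| * qform 1%:M v <= m0 / 2 * qform 1%:M v.
    by rewrite ler_wpM2r.
  have h4 : m * qform 1%:M v <= m0 / 2 * qform 1%:M v by rewrite ler_wpM2r// ltW.
  move: (qform (b x) v) (qform (b y) v) (qform 1%:M v) (K * nn * _) h0 h1 h3 h4.
  by clear => p q Q L; lra.
move=> near_m; have [m [hm m0]] :=
  @filter_ex R (at_right 0) _ _ (filterI near_m (nbhs_right_gt 0)).
by exists m => // t tcd; apply: hm; rewrite /= in_itv.
Qed.

Variable N : M -> R.
Hypothesis hN : unitarily_invariant_norm N.

Lemma whitened_le Z W V (m : R) : 0 < m -> posdef Z -> posdef W ->
  loewner (m%:C *: 1%:M) Z -> loewner (m%:C *: 1%:M) W ->
  whitened N Z V W <= m^-1 * N V.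
Proof.
move=> m0 pZ pW hZ hW; have p1 := @posdef1 R n.
have -> : N V = whitened N 1%:M V 1%:M.
  by rewrite /whitened mxpowR_one mul1mx mulmx1.
exact: (whitened_loewner hN V m0 p1 p1 pZ pW hZ hW).
Qed.

Lemma smooth_piece_estimate (b : R -> M) (c d th eps : R) : mxsmooth b -> c <= d ->
  (forall t, c <= t <= d -> posdef (b t)) -> 0 < th < 1 -> 0 < eps ->
  exists delta K : R, [/\ 0 < delta, 0 <= K & forall u v, c <= u -> u <= v -> v <= d ->
    v - u <= delta -> nearby th (b u) (b v) /\
    forall t, u <= t <= v ->
      (1 - th) * relnorm N (b u) (b v) <= (v - u) * (speed N b t + eps) /\
      speed N b t <= K].
Proof.
move=> sb cd pb /andP[th0 th1] eps0; have [K K0 hK] := mxsmooth_estimate sb cd.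
have [m m0 hm] := mxsmooth_lower_bound sb cd pb.
pose nn : R := \sum_(i < n) \sum_(j < n) 1.
have nn0 : 0 <= nn by rewrite sumr_ge0// => i _; rewrite sumr_ge0.
pose S : R := \sum_(i < n) \sum_(j < n) N (delta_mx i j).
have S0 : 0 <= S by rewrite sumr_ge0// => i _; rewrite sumr_ge0// => j _; exact: uinorm_ge0.
have NS (E : M) k : (forall i j, Normc.normc (E i j) <= k) -> N E <= k * S.
  move=> Ek; apply: le_trans (uinorm_entries hN E) _.
  rewrite mulr_sumr; apply: ler_sum => i _; rewrite mulr_sumr; apply: ler_sum => j _.
  by rewrite ler_wpM2r ?uinorm_ge0.
have Kn : 0 < K * nn + 1 by rewrite ltr_wpDl// mulr_ge0.
have KS : 0 < K * S + 1 by rewrite ltr_wpDl// mulr_ge0.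
(* The first bound on the step keeps the variation of b below th m, hence below th b, which gives
   [nearby]. The second keeps the Taylor remainder, at most K S (v - u)^2 in norm and 1/m times that
   once whitened, below (v - u) eps. *)
exists (Num.min (th * m / (K * nn + 1)) (eps * m / (K * S + 1))), (m^-1 * (K * S)); split.
- by rewrite lt_min !divr_gt0// mulr_gt0.
- by rewrite mulr_ge0 ?mulr_ge0// invr_ge0 ltW.
move=> u v cu uv vd; rewrite le_min => /andP[d1 d2].
have du : 0 <= v - u by rewrite subr_ge0.
have hth : K * nn * (v - u) <= th * m.
  rewrite (@le_trans _ _ ((K * nn + 1) * (v - u)))//; first by rewrite ler_wpM2r// lerDl.
  by rewrite mulrC -ler_pdivlMr.
have heps : K * S * (v - u) <= eps * m.
  rewrite (@le_trans _ _ ((K * S + 1) * (v - u)))//; first by rewrite ler_wpM2r// lerDl.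
  by rewrite mulrC -ler_pdivlMr.
have inI t : u <= t -> t <= v -> c <= t <= d.
  by move=> ut tv; rewrite (le_trans cu ut) (le_trans tv vd).
have close p q : u <= p -> p <= q -> q <= v -> nearby th (b p) (b q).
  move=> up pq qv; have qd := le_trans qv vd; have cp := le_trans cu up.
  have bnd w : `|qform (b q) w - qform (b p) w| <= th * (m * qform 1%:M w).
    rewrite -qformB; apply: le_trans (qform_bound _ _) _.
    rewrite mulrA ler_wpM2r ?qform1_ge0//; apply: le_trans hth.
    rewrite mulrAC; apply: sum_entries_le => i j.
    have [_ _ h] := hK p p q cp (lexx p) pq qd i j; apply: le_trans h _.
    by rewrite ler_wpM2l//; lra.
  have low t w : u <= t -> t <= v -> m * qform 1%:M w <= qform (b t) w.
    by move=> ut tv; have := hm t (inI t ut tv) w; rewrite qformZ.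
  split=> w; rewrite qformZ; have := bnd w; rewrite ler_norml => /andP[b1 b2].
    have : th * (m * qform 1%:M w) <= th * qform (b p) w.
      by rewrite ler_wpM2l ?(ltW th0)// low//; exact: le_trans qv.
    move: b1 b2; move: (qform _ _) (qform _ _) (th * (m * _)); clear => x y z; lra.
  have : th * (m * qform 1%:M w) <= th * qform (b q) w.
    by rewrite ler_wpM2l ?(ltW th0)// low//; exact: le_trans pq.
  move: b1 b2; move: (qform _ _) (qform _ _) (th * (m * _)); clear => x y z; lra.
split; first exact: close.
move=> t /andP[ut tv]; have tI := inI t ut tv.
have pt := pb t tI; have mt := hm t tI.
have pu : posdef (b u) by apply: pb; apply: inI.
have pv : posdef (b v) by apply: pb; apply: inI.
have hKt i j := hK u t v cu ut tv vd i j.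
split; last first.
  rewrite /speed; apply: le_trans (whitened_le _ m0 pt pt mt mt) _.
  rewrite ler_wpM2l ?invr_ge0 ?(ltW m0)//; apply: NS => i j.
  by have [] := hKt i j.
have th1' : 0 < 1 - th by rewrite subr_gt0.
(* Both whitenings, at b u and at b v, are moved to the single point b t where the speed is
   taken. *)
have h1 : relnorm N (b u) (b v) <= (1 - th)^-1 * whitened N (b t) (b v - b u) (b t).
  have [_ ut_le] := close u t (lexx u) ut tv.
  have [tv_le _] := close t v ut tv (lexx v).
  exact: (whitened_loewner hN _ th1' pt pt pu pv ut_le tv_le).
rewrite -(ler_pM2l th1') mulVKf ?gt_eqF// in h1.
apply: le_trans h1 _.
pose E := b v - b u - (v - u)%:C *: velocity b t.
have -> : b v - b u = (v - u)%:C *: velocity b t + E by rewrite /E subrKC.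
have wD X Y : whitened N (b t) (X + Y) (b t) <= whitened N (b t) X (b t) + whitened N (b t) Y (b t).
  by rewrite /whitened mulmxDr mulmxDl; exact: uinorm_triangle hN _ _.
apply: le_trans (wD _ _) _; rewrite mulrDr; apply: lerD.
  by rewrite /speed /whitened -scalemxAr -scalemxAl (uinormZ hN) ger0_norm.
apply: le_trans (whitened_le _ m0 pt pt mt mt) _.
rewrite ler_pdivrMl//; apply: (@le_trans _ _ (K * (v - u) ^+ 2 * S)).
  by apply: NS => i j; have [] := hKt i j.
have -> : K * (v - u) ^+ 2 * S = (v - u) * (K * S * (v - u)) by ring.
by rewrite [leRHS]mulrCA ler_wpM2l// (mulrC m).
Qed.

End SmoothPiece.

(** * Chains whose sums nearly stay below the length of a given curve *)

Section LowerBound.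
Context {R : realType} {n : nat}.
Local Notation C := R[i].
Local Notation M := 'M[C]_n.
Local Notation mu := (@lebesgue_measure R).
Variable N : M -> R.
Hypothesis hN : unitarily_invariant_norm N.

(* The lower step function h stands in for the speed, which is not known to be
   measurable; the bound B makes the integral of the speed finite. *)
Definition discretizable (th eps : R) (a : R -> M) (c d : R) : Prop :=
  exists r l B (h : R -> R), [/\ chain N th (a c) (a d) r,
    (1 - th) * r <= l + eps * (d - c),
    forall x, c <= x <= d -> speed N a x <= B,
    measurable_fun setT h /\ (\int[mu]_x (h x)%:E = l%:E)%E &
    (forall x, 0 <= h x) /\
      forall x, h x <= if c < x < d then speed N a x else 0].

Lemma discretizable_refl th eps a c : posdef (a c) -> discretizable th eps a c c.
Proof.
move=> pa; exists 0, 0, (speed N a c), (cst 0); split.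
- exact: chain_nil.
- by rewrite subrr !mulr0 addr0.
- by move=> x; rewrite -eq_le => /eqP ->.
- by split; [exact: measurable_cst|rewrite integral0].
- split=> // x; case: ifP => // _; exact: speed_ge0.
Qed.

(** Each step function vanishes outside its open interval, so at no point are both positive and
    their sum stays below the speed. At the junction e both are 0, whatever the speed is there. *)
Lemma discretizable_cat th eps a c e d : c <= e -> e <= d ->
  discretizable th eps a c e -> discretizable th eps a e d ->
  discretizable th eps a c d.
Proof.
move=> ce ed [r1 [l1 [B1 [h1 [ch1 le1 sp1 [m1 i1] [p1 u1]]]]]].
move=> [r2 [l2 [B2 [h2 [ch2 le2 sp2 [m2 i2] [p2 u2]]]]]].
exists (r1 + r2), (l1 + l2), (Num.max B1 B2), (h1 \+ h2); split.
- exact: chain_cat ch1 ch2.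
- by move: le1 le2; lra.
- move=> x /andP[cx xd]; rewrite le_max; case: (leP x e) => xe.
    by rewrite sp1 ?cx ?xe.
  by rewrite (sp2 x) ?orbT// (ltW xe) xd.
- split; first exact: measurable_funD.
  under eq_integral do rewrite EFinD.
  rewrite ge0_integralD//; [by rewrite i1 i2| | | |].
  + by move=> x _; rewrite lee_fin.
  + exact/measurable_EFinP.
  + by move=> x _; rewrite lee_fin.
  + exact/measurable_EFinP.
- split=> [x|x]; first by rewrite addr_ge0.
  have := speed_ge0 hN a x; have := u1 x; have := u2 x; rewrite /=.
  case: (ltgtP x e) => [xe|xe|->].
  + rewrite andbT /= (lt_le_trans xe ed) andbT => h2x h1x _.
    by apply: le_trans (lerD h1x h2x) _; rewrite addr0.
  + rewrite (le_lt_trans ce xe) /= => h2x h1x _.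
    by apply: le_trans (lerD h1x h2x) _; rewrite add0r.
  + rewrite andbF => h2x h1x s0; apply: le_trans (lerD h1x h2x) _.
    by rewrite addr0; case: (_ && _).
Qed.

Lemma discretizable_small th eps a b c d u v K : 0 < th < 1 -> 0 < eps ->
  {in `[c, d], a =1 b} -> (forall t, c <= t <= d -> posdef (a t)) ->
  c <= u -> u < v -> v <= d -> nearby th (b u) (b v) ->
  (forall t, u <= t <= v ->
      (1 - th) * relnorm N (b u) (b v) <= (v - u) * (speed N b t + eps) /\
      speed N b t <= K) ->
  discretizable th eps a u v.
Proof.
move=> /andP[th0 th1] eps0 ab pa cu uv vd nb est.
have uI : u \in `[c, d] by rewrite in_itv /= cu (le_trans (ltW uv)).
have vI : v \in `[c, d] by rewrite in_itv /= vd (le_trans cu (ltW uv)).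
have pu : posdef (a u) by apply: pa; move: uI; rewrite in_itv.
have pv : posdef (a v) by apply: pa; move: vI; rewrite in_itv.
have sp t : u < t < v -> speed N a t = speed N b t.
  move=> /andP[ut tv].
  have ct := le_lt_trans cu ut; have td := lt_le_trans tv vd.
  rewrite /speed (@velocity_near_eq _ _ a b) ?ab ?in_itv /= ?(ltW ct) ?(ltW td)//.
  near=> s; apply: ab; apply: subset_itv_oo_cc.
  by near: s; apply: near_in_itvoo; rewrite in_itv /= ct.
have vu : 0 < v - u by rewrite subr_gt0.
(* The largest constant that the estimate places below the speed, cut at 0 to keep the step function
   nonnegative. *)
pose k := Num.max 0 ((1 - th) * relnorm N (b u) (b v) / (v - u) - eps).
have k0 : 0 <= k by rewrite le_max lexx.
have ks t : u < t < v -> k <= speed N a t.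
  move=> utv; rewrite ge_max (speed_ge0 hN) (sp t utv) /=.
  have /andP[ut tv] := utv; have [] := est t; first by rewrite !ltW.
  by rewrite -ler_pdivrMl// mulrC lerBlDr.
(* At u and v the curve a may agree with b on one side only, so its velocity there is not controlled
   by K; the two end speeds enter the bound separately. *)
exists (relnorm N (a u) (a v) + 0), (k * (v - u)),
  (Num.max K (Num.max (speed N a u) (speed N a v))), (fun x => k * \1_(`]u, v[%classic) x); split.
- rewrite (ab u uI) (ab v vI) in pu pv *.
  exact: (chain_cons pu nb (chain_nil _ _ pv)).
- rewrite addr0 (ab u uI) (ab v vI) -mulrDl -ler_pdivrMr//.
  by rewrite -lerBlDr /k le_max lexx orbT.
- move=> x /andP[ux xv]; rewrite !le_max.
  have [->|xu] := eqVneq x u; first by apply/orP; right; apply/orP; left.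
  have [->|xv'] := eqVneq x v; first by apply/orP; right; apply/orP; right.
  rewrite sp ?(est x _).2 ?ux ?xv//.
  by rewrite !lt_neqAle ux xv eq_sym xu xv'.
- split; first exact: measurable_funM.
  under eq_integral do rewrite EFinM.
  rewrite ge0_integralZl_EFin//; [|exact/measurable_EFinP].
  have -> : (\int[mu]_x (\1_(`]u, v[%classic) x)%:E = mu (`]u, v[%classic `&` setT))%E.
    exact: integral_indic.
  by rewrite setIT lebesgue_measure_itv /= lte_fin uv -EFinD EFinM.
- split=> x; first by rewrite mulr_ge0.
  rewrite indicE; case: ifP => [xuv|xuv].
    by rewrite mem_set /= ?in_itv// mulr1 ks.
  by rewrite memNset ?mulr0//= in_itv /= xuv.
Unshelve. all: by end_near. Qed.

Lemma discretizable_piece th eps a b c d : 0 < th < 1 -> 0 < eps -> mxsmooth b ->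
  {in `[c, d], a =1 b} -> (forall t, c <= t <= d -> posdef (a t)) -> c < d ->
  discretizable th eps a c d.
Proof.
move=> th01 eps0 sb ab pa cd.
have pb t : c <= t <= d -> posdef (b t) by move=> tcd; rewrite -ab ?in_itv//; exact: pa.
have [delta [K [delta0 K0 est]]] := smooth_piece_estimate hN sb (ltW cd) pb th01 eps0.
(* The successor makes p exceed (d - c) / delta, so p equal steps have length at most [delta]. *)
pose p := (Num.truncn ((d - c) / delta)).+1.
have p0 : (0 : R) < p%:R by rewrite ltr0n.
have hp : (d - c) / p%:R <= delta.
  rewrite ler_pdivrMr// mulrC -ler_pdivrMr//; exact/ltW/truncnS_gt.
have h0 : 0 < (d - c) / p%:R by rewrite divr_gt0// subr_gt0.
pose e k := c + (d - c) / p%:R * k%:R.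
have e0 : e 0%N = c by rewrite /e mulr0 addr0.
have ep : e p = d by rewrite /e divfK ?gt_eqF// subrKC.
have eS k : e k.+1 - e k = (d - c) / p%:R by rewrite /e -natr1; ring.
have e_le i j : (i <= j)%N -> e i <= e j.
  by move=> ij; rewrite /e lerD2l ler_pM2l// ler_nat.
have: forall k, (k <= p)%N -> discretizable th eps a c (e k).
  elim=> [_|k IH kp].
    by rewrite e0; apply: discretizable_refl; apply: pa; rewrite lexx ltW.
  have ck : c <= e k by rewrite -e0 e_le.
  have kd : e k.+1 <= d by rewrite -ep e_le.
  have kk : e k < e k.+1 by rewrite -subr_gt0 eS.
  apply: (discretizable_cat ck (ltW kk) (IH (ltnW kp))).
  have step_le : e k.+1 - e k <= delta by rewrite eS.
  have [nb es] := est (e k) (e k.+1) ck (ltW kk) kd step_le.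
  exact: (discretizable_small th01 eps0 ab pa ck kk kd nb es).
by move=> /(_ p (leqnn p)); rewrite ep.
Qed.

Lemma discretizable_partition th eps a (s : seq R) (c d : R) : 0 < th < 1 -> 0 < eps ->
  itv_partition c d s -> (forall t, c <= t <= d -> posdef (a t)) ->
  (forall i, (i < size s)%N -> exists2 b : R -> M, mxsmooth b &
      {in `[nth 0 (c :: s) i, nth 0 s i], a =1 b}) ->
  discretizable th eps a c d.
Proof.
move=> th01 eps0; elim: s c => [|x s IH] c.
  move=> /itv_partition_nil <- pa _; apply: discretizable_refl.
  by apply: pa; rewrite lexx.
move=> sp pa hb.
have sp' := itv_partition_cons sp; have xd := itv_partition_le sp'.
have cx : c < x by case: sp => /= /andP[].
have [b sb ab] := hb 0%N isT.
apply: (@discretizable_cat _ _ _ _ x) => //; first exact: ltW.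
  apply: (discretizable_piece th01 eps0 sb ab) => // t /andP[ct tx].
  by apply: pa; rewrite ct (le_trans tx).
apply: IH => //; last by move=> i; exact: (hb i.+1).
by move=> t /andP[xt td]; apply: pa; rewrite td (le_trans (ltW cx)).
Qed.

Lemma chain_of_curve th a A B r : 0 < th < 1 -> joining_curve A B a ->
  curve_length N a < r -> exists2 r', chain N th A B r' & (1 - th) * r' < r.
Proof.
move=> th01 [[s sp hb] pa <- <-] Lr.
pose eps := (r - curve_length N a) / 2.
have eps0 : 0 < eps by rewrite divr_gt0// subr_gt0.
have pa' t : 0 <= t <= 1 -> posdef (a t) by move=> t01; apply: pa; rewrite in_itv.
have [r' [l [K [h [ch le_r sK [mh ih] [h0 hs]]]]]] :=
  discretizable_partition th01 eps0 sp pa' hb.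
exists r' => //; apply: le_lt_trans le_r _.
suff : l <= curve_length N a by rewrite /eps subr0 mulr1; lra.
pose D : set R := `[0, 1]%classic.
have F0 t : D t -> (0 <= (speed N a t)%:E)%E.
  by move=> _; rewrite lee_fin; exact: speed_ge0.
have lF : (l%:E <= \int[mu]_(t in D) (speed N a t)%:E)%E.
  rewrite -ih [leRHS]integral_mkcond; apply: ge0_le_integral_nomeas => x _.
    by rewrite lee_fin.
  rewrite /patch; case: ifPn => [_|]; first last.
    rewrite notin_setE /D /= in_itv /= => xI; rewrite lee_fin; apply: le_trans (hs x) _.
    by case: ifP => // /andP[x0 x1]; case: xI; rewrite !ltW.
  rewrite lee_fin; apply: le_trans (hs x) _; case: ifP => // _; exact: speed_ge0.
(* Finiteness matters: [fine] would turn an infinite integral into the length 0, and the lower bound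
   would be lost. *)
have FK : (\int[mu]_(t in D) (speed N a t)%:E <= K%:E)%E.
  apply: (@le_trans _ _ (\int[mu]_(t in D) (cst K%:E t))%E).
    apply: ge0_le_integral_nomeas => // x; rewrite /D /= in_itv /= lee_fin; exact: sK.
  have mD : measurable D by exact: measurable_itv.
  rewrite (integral_cst mu mD) /D /= lebesgue_measure_itv /= lte_fin ltr01.
  by rewrite oppr0 adde0 mule1.
have h1 : (0 <= \int[mu]_(t in D) (speed N a t)%:E)%E by exact: integral_ge0.
rewrite /curve_length -/D /Rintegral -lee_fin fineK// fin_numElt (lt_le_trans _ h1)//=.
by apply: le_lt_trans FK _; rewrite ltry.
Qed.

Lemma chain_of_dist th A B r : 0 < th < 1 -> posdef A -> posdef B ->
  dist N A B < r -> exists2 r', chain N th A B r' & (1 - th) * r' < r.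
Proof.
move=> th01 pA pB; rewrite /dist => dr.
set S := (X in inf X) in dr.
have iS : has_inf S.
  split; last by exists 0 => _ [b _ <-]; exact: curve_length_ge0.
  by have [a ja] := joining_curve_exists pA pB; exists (curve_length N a), a.
have [|_ [a ja <-]] := @inf_adherent _ S (r - inf S) _ iS; first by rewrite subr_gt0.
by rewrite subrKC => La; exact: chain_of_curve ja La.
Qed.

End LowerBound.

(** * Convexity of the distance *)

Section Distance.
Context {R : realType} {n : nat}.
Local Notation C := R[i].
Local Notation M := 'M[C]_n.
Implicit Types (A B D X Z : M).
Variable N : M -> R.
Hypothesis hN : unitarily_invariant_norm N.
Local Notation d := (dist N).

Lemma dist_ge0 A B : posdef A -> posdef B -> 0 <= d A B.
Proof.
move=> pA pB; apply: lb_le_inf; last by move=> _ [b _ <-]; exact: curve_length_ge0.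
by have [a ja] := joining_curve_exists pA pB; exists (curve_length N a), a.
Qed.

(** One factor 1 - th comes from passing from a curve to a chain, the other from passing back to a
    curve. *)
Lemma le_of_approx (x y c : R) : 0 <= x -> 0 <= c ->
  (forall th r, 0 < th < 1 -> y < r -> (1 - th) ^+ 2 * x <= c * r) -> x <= c * y.
Proof.
move=> x0 c0 h.
have xr r : y < r -> x <= c * r.
  move=> yr; apply/ler_addgt0Pr => e e0.
  (* This makes 2 th x <= e, so (1 - th)^2 x >= x - e. *)
  pose th := Num.min 2^-1 (e / (2 * (x + 1))).
  have x1 : 0 < 2 * (x + 1) by rewrite mulr_gt0// ltr_wpDl.
  have th0 : 0 < th by rewrite lt_min invr_gt0 ltr0n divr_gt0.
  have th1 : th < 1 by rewrite gt_min; apply/orP; left; lra.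
  have th2 : 2 * th * x <= e.
    have : th <= e / (2 * (x + 1)) by rewrite ge_min lexx orbT.
    by rewrite ler_pdivlMr//; nra.
  have := h th r; rewrite th0 th1 => /(_ isT yr); nra.
apply/ler_addgt0Pr => e e0.
have c1 : 0 < c + 1 by rewrite ltr_wpDl.
apply: le_trans (xr (y + e / (c + 1)) _) _; first by rewrite ltrDl divr_gt0.
by rewrite mulrDr lerD2l mulrCA ler_piMr ?(ltW e0)// ler_pdivrMr// mul1r lerDl.
Qed.

Lemma dist_map (f : M -> M) (c : R) A B : 0 <= c ->
  (forall X, posdef X -> posdef (f X)) ->
  (forall th X Y, 0 < th < 1 -> posdef X -> posdef Y ->
     nearby th X Y -> nearby th (f X) (f Y)) ->
  (forall X Y, posdef X -> posdef Y -> relnorm N (f X) (f Y) <= c * relnorm N X Y) ->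
  posdef A -> posdef B -> d (f A) (f B) <= c * d A B.
Proof.
move=> c0 pf nf rf pA pB; apply: le_of_approx => //.
  by apply: dist_ge0; exact: pf.
move=> th r th01 dr; have [r' ch r'r] := chain_of_dist hN th01 pA pB dr.
have /andP[th0 th1] := th01; have th1' : 0 < 1 - th by rewrite subr_gt0.
have [s sr ch'] := chain_map c0 pf (fun X Y => @nf th X Y th01) rf ch.
have := dist_le_chain hN th01 ch'; rewrite ler_pdivlMr// => h.
rewrite expr2 -mulrA (mulrC _ (d _ _)) (le_trans (ler_wpM2l (ltW th1') h))//.
rewrite (le_trans (ler_wpM2l (ltW th1') sr))// mulrCA ler_wpM2l//; exact: ltW.
Qed.

(** Chains concatenate directly, without reparametrizing curves. The slack between r and the two
    distances is shared equally by the two chains. *)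
Lemma dist_triangle A B D : posdef A -> posdef B -> posdef D ->
  d A D <= d A B + d B D.
Proof.
move=> pA pB pD; rewrite -[leRHS]mul1r; apply: le_of_approx => //.
  exact: dist_ge0.
move=> th r th01; rewrite mul1r => hr.
have /andP[th0 th1] := th01; have th1' : 0 < 1 - th by rewrite subr_gt0.
pose e := (r - (d A B + d B D)) / 2.
have e0 : 0 < e by rewrite divr_gt0// subr_gt0.
have lte x : x < x + e by rewrite ltrDl.
have [r1 ch1 h1] := chain_of_dist hN th01 pA pB (lte _).
have [r2 ch2 h2] := chain_of_dist hN th01 pB pD (lte _).
have := dist_le_chain hN th01 (chain_cat ch1 ch2); rewrite ler_pdivlMr// => h.
rewrite expr2 -mulrA (mulrC _ (d _ _)) (le_trans (ler_wpM2l (ltW th1') h))//.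
by rewrite mulrDr; move: h1 h2; rewrite /e; lra.
Qed.

Lemma dist_conj_le A B X : X \in unitmx -> posdef A -> posdef B ->
  d (X *m A *m X^t*) (X *m B *m X^t*) <= d A B.
Proof.
move=> uX pA pB; rewrite -[leRHS]mul1r.
apply: (dist_map (f := fun Z => X *m Z *m X^t*)) pA pB; first exact: ler01.
- by move=> Z; exact: posdef_conj.
- by move=> th Y Z _ _ _; exact: nearby_conj.
- by move=> Y Z pY pZ; rewrite mul1r (relnorm_conj hN uX pY pZ).
Qed.

Lemma dist_conj A B X : X \in unitmx -> posdef A -> posdef B ->
  d (X *m A *m X^t*) (X *m B *m X^t*) = d A B.
Proof.
move=> uX pA pB; apply/eqP; rewrite eq_le dist_conj_le//=.
have uX' : invmx X \in unitmx by rewrite unitmx_inv.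
have K Z : invmx X *m (X *m Z *m X^t*) *m (invmx X)^t* = Z.
  rewrite !mulmxA (mulVmx uX) mul1mx -mulmxA -adjM (mulVmx uX) adj1 mulmx1//.
have := dist_conj_le uX' (posdef_conj uX pA) (posdef_conj uX pB).
by rewrite !K.
Qed.

Lemma dist_sqrt A B : posdef A -> posdef B ->
  d (mxpowR A 2^-1) (mxpowR B 2^-1) <= 2^-1 * d A B.
Proof.
move=> pA pB; apply: (dist_map (f := fun Z => mxpowR Z 2^-1)) pA pB.
- by rewrite invr_ge0.
- by move=> Z; exact: mxpowR_posdef.
- by move=> th Y Z th01 pY pZ; exact: nearby_sqrt.
- by move=> Y Z pY pZ; exact: relnorm_sqrt.
Qed.

(** Congruence by A^p adds 2p to every exponent of A. *)
Lemma dist_powR_shift A p u v : posdef A ->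
  d (mxpowR A u) (mxpowR A v) = d (mxpowR A (p + u + p)) (mxpowR A (p + v + p)).
Proof.
move=> pA; rewrite -(mxpowR_conj p u pA) -(mxpowR_conj p v pA).
by rewrite (dist_conj (mxpowR_unit p pA) (mxpowR_posdef u pA) (mxpowR_posdef v pA)).
Qed.

(** Go through Z^(1/2). Congruence by Z^(-1/4) gives d(Z, Z^(1/2)) = d(Z^(1/2), 1), and the square
    root halves both d(Z, 1) and d(Z, A). *)
Lemma dist_sqrt_r A Z : posdef A -> posdef Z ->
  d Z (mxpowR A 2^-1) <= 2^-1 * (d Z 1%:M + d Z A).
Proof.
move=> pA pZ; have p1 := @posdef1 R n.
have pZ2 := mxpowR_posdef 2^-1 pZ; have pA2 := mxpowR_posdef 2^-1 pA.
apply: le_trans (dist_triangle pZ pZ2 pA2) _.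
rewrite mulrDr; apply: lerD; last exact: dist_sqrt.
have := dist_sqrt pZ p1; rewrite mxpowR_one; apply: le_trans.
have := dist_powR_shift (- (2^-1 / 2)) 1 2^-1 pZ; rewrite (mxpowR1 pZ) => ->.
have -> : - (2^-1 / 2) + 1 + - (2^-1 / 2) = 2^-1 :> R by lra.
have -> : - (2^-1 / 2) + 2^-1 + - (2^-1 / 2) = 0 :> R by lra.
by rewrite (mxpowR0 pZ).
Qed.

Lemma dist_sqrt_l A Z : posdef A -> posdef Z ->
  d (mxpowR A 2^-1) Z <= 2^-1 * (d 1%:M Z + d A Z).
Proof.
move=> pA pZ; have p1 := @posdef1 R n.
have pZ2 := mxpowR_posdef 2^-1 pZ; have pA2 := mxpowR_posdef 2^-1 pA.
apply: le_trans (dist_triangle pA2 pZ2 pZ) _.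
rewrite mulrDr addrC; apply: lerD; last exact: dist_sqrt.
have := dist_sqrt p1 pZ; rewrite mxpowR_one; apply: le_trans.
have := dist_powR_shift (- (2^-1 / 2)) 2^-1 1 pZ; rewrite (mxpowR1 pZ) => ->.
have -> : - (2^-1 / 2) + 1 + - (2^-1 / 2) = 2^-1 :> R by lra.
have -> : - (2^-1 / 2) + 2^-1 + - (2^-1 / 2) = 0 :> R by lra.
by rewrite (mxpowR0 pZ).
Qed.

(** Congruence by A^(-u/2) moves the exponents u, v and (u + v)/2 to 0, v - u and (v - u)/2, which
    is the case of [dist_sqrt_r] for A^(v - u). *)
Lemma dist_midpoint_r A Z u v : posdef A -> posdef Z ->
  d Z (mxpowR A ((u + v) / 2)) <= 2^-1 * (d Z (mxpowR A u) + d Z (mxpowR A v)).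
Proof.
move=> pA pZ; have uQ := mxpowR_unit (- (u / 2)) pA.
have pp s := mxpowR_posdef s pA.
pose Z' := mxpowR A (- (u / 2)) *m Z *m (mxpowR A (- (u / 2)))^t*.
have pZ' : posdef Z' by exact: posdef_conj.
have shift s w : - (u / 2) + s + - (u / 2) = w -> d Z (mxpowR A s) = d Z' (mxpowR A w).
  by move=> <-; rewrite -(mxpowR_conj _ _ pA); apply/esym; exact: (dist_conj uQ pZ (pp s)).
have e0 : d Z (mxpowR A u) = d Z' 1%:M.
  by rewrite (shift u 0) ?(mxpowR0 pA)//; field.
have e1 : d Z (mxpowR A v) = d Z' (mxpowR A (v - u)) by apply: shift; field.
have e2 : d Z (mxpowR A ((u + v) / 2)) = d Z' (mxpowR A ((v - u) / 2)) by apply: shift; field.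
have e3 := etrans e2 (f_equal (fun W => d Z' W) (esym (mxpowR_half (v - u) pA))).
have congr_half (a b c a' b' c' : R) : a = a' -> b = b' -> c = c' ->
    a' <= 2^-1 * (b' + c') -> a <= 2^-1 * (b + c) by move=> -> -> ->.
exact: (congr_half _ _ _ _ _ _ e3 e0 e1 (dist_sqrt_r (pp _) pZ')).
Qed.

Lemma dist_midpoint_l A Z u v : posdef A -> posdef Z ->
  d (mxpowR A ((u + v) / 2)) Z <= 2^-1 * (d (mxpowR A u) Z + d (mxpowR A v) Z).
Proof.
move=> pA pZ; have uQ := mxpowR_unit (- (u / 2)) pA.
have pp s := mxpowR_posdef s pA.
pose Z' := mxpowR A (- (u / 2)) *m Z *m (mxpowR A (- (u / 2)))^t*.
have pZ' : posdef Z' by exact: posdef_conj.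
have shift s w : - (u / 2) + s + - (u / 2) = w -> d (mxpowR A s) Z = d (mxpowR A w) Z'.
  by move=> <-; rewrite -(mxpowR_conj _ _ pA); apply/esym; exact: (dist_conj uQ (pp s) pZ).
have e0 : d (mxpowR A u) Z = d 1%:M Z'.
  by rewrite (shift u 0) ?(mxpowR0 pA)//; field.
have e1 : d (mxpowR A v) Z = d (mxpowR A (v - u)) Z' by apply: shift; field.
have e2 : d (mxpowR A ((u + v) / 2)) Z = d (mxpowR A ((v - u) / 2)) Z' by apply: shift; field.
have e3 := etrans e2 (f_equal (fun W => d W Z') (esym (mxpowR_half (v - u) pA))).
have congr_half (a b c a' b' c' : R) : a = a' -> b = b' -> c = c' ->
    a' <= 2^-1 * (b' + c') -> a <= 2^-1 * (b + c) by move=> -> -> ->.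
exact: (congr_half _ _ _ _ _ _ e3 e0 e1 (dist_sqrt_l (pp _) pZ')).
Qed.

(** For small r the pair 1, A^r is a chain with one step and th = 1/2: the eigenvalues of A^r lie
    between 1/2 and 2, and the sinh multipliers tend to 0. The distance is then at most twice
    [relnorm]. *)
Lemma dist_powR_near0 A (e : R) : posdef A -> 0 < e ->
  exists2 delta : R, 0 < delta & forall r, `|r| < delta -> d 1%:M (mxpowR A r) <= e.
Proof.
move=> pA e0; have p1 := @posdef1 R n.
have th01 : 0 < (2^-1 : R) < 1 by apply/andP; split; lra.
have [a [b [Y rel]]] := relnorm_powR hN p1 pA.
have [U [g [uU g0 _ AE]]] := posdef_spectral pA.
have cexp (k : R) : expR (r * k) @[r --> (0 : R)] --> (1 : R).
  rewrite -expR0 -[in X in _ --> X](mul0r k).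
  by apply: continuous_cvg; [exact: continuous_expR|apply: cvgMl; exact: cvg_id].
have cs : \sum_i \sum_j `|expR (r * (2^-1 * (b j - a i))) -
      expR (r * - (2^-1 * (b j - a i)))| *
    (Normc.normc (Y i j) * N (delta_mx i j)) @[r --> (0 : R)] --> (0 : R).
  have z0 : \sum_(i < n) \sum_(j < n) (`|1 - 1 : R| *
      (Normc.normc (Y i j) * N (delta_mx i j))) = 0.
    by rewrite big1// => i _; rewrite big1// => j _; rewrite subrr normr0 mul0r.
  rewrite -[X in _ --> X]z0.
  apply: cvg_big => [|i _]; first exact: add_continuous.
  apply: cvg_big => [|j _]; first exact: add_continuous.
  by apply: cvgMl; apply: cvg_norm; apply: cvgB; exact: cexp.
have near1 : \forall r \near (0 : R), forall i, 2^-1 < g 0 i `^ r < 2.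
  apply: (@filter_forall R _ (fun i r => is_true (2^-1 < g 0 i `^ r < 2))
    (nbhs (0 : R)) _) => i.
  have h1 : \forall r \near (0 : R), expR (r * ln (g 0 i)) < 2.
    by apply: (cvgr_lt _ (cexp _)); lra.
  have h2 : \forall r \near (0 : R), 2^-1 < expR (r * ln (g 0 i)).
    by apply: (cvgr_gt _ (cexp _)); lra.
  by apply: filterS2 h1 h2 => r r1 r2; rewrite /powR gt_eqF// r1 r2.
have near2 : \forall r \near (0 : R), relnorm N 1%:M (mxpowR A r) < e / 2.
  have : \forall r \near (0 : R), \sum_i \sum_j `|expR (r * (2^-1 * (b j - a i))) -
      expR (r * - (2^-1 * (b j - a i)))| *
    (Normc.normc (Y i j) * N (delta_mx i j)) < e / 2.
    by apply: (cvgr_lt _ cs); rewrite divr_gt0.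
  apply: filterS => r; apply: le_lt_trans.
  rewrite -{1}(mxpowR_one r) rel; apply: le_trans (uinorm_entries hN _) _.
  apply: ler_sum => i _; apply: ler_sum => j _.
  by rewrite mxE Normc.normcM normcR mulrN mulrA mulrA.
have /nbhs_ballP[delta /= delta0 hd] : \forall r \near (0 : R), d 1%:M (mxpowR A r) <= e.
  apply: filterS2 near1 near2 => r gr rr.
  have nb : nearby 2^-1 1%:M (mxpowR A r).
    rewrite AE -(unitary_rdiag1 uU).
    by split; apply: (loewner_unitary uU) => i; rewrite !mxE; have := gr i; lra.
  have ch := chain_cons p1 nb (chain_nil N 2^-1 (mxpowR_posdef r pA)).
  apply: le_trans (dist_le_chain hN th01 ch) _.
  by rewrite addr0 ler_pdivrMr; lra.
exists delta => // r rd; apply: hd.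
by rewrite /ball /= sub0r normrN.
Qed.

Lemma dist_powR_continuous A (e : R) : posdef A -> 0 < e ->
  exists2 delta : R, 0 < delta &
    forall u v, `|v - u| < delta -> d (mxpowR A u) (mxpowR A v) <= e.
Proof.
move=> pA e0; have [delta delta0 h] := dist_powR_near0 pA e0.
exists delta => // u v uv; rewrite (dist_powR_shift (- (u / 2)) _ _ pA).
have -> : - (u / 2) + u + - (u / 2) = 0 by lra.
have -> : - (u / 2) + v + - (u / 2) = v - u by lra.
by rewrite (mxpowR0 pA); exact: h.
Qed.

Lemma bisection (S : R -> Prop) s k : S 0 -> S 1 ->
  (forall u v, S u -> S v -> S ((u + v) / 2)) -> 0 <= s <= 1 ->
  exists u v, [/\ S u, S v, u <= s <= v & v - u <= 2^-1 ^+ k].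
Proof.
move=> S0 S1 Sm s01; elim: k => [|k [u [v [Su Sv /andP[us sv] uv]]]].
  by exists 0, 1; split=> //; rewrite expr0 subr0.
have [sm|/ltW ms] := leP s ((u + v) / 2).
  exists u, ((u + v) / 2); split=> //; [exact: Sm|by rewrite us|].
  by rewrite exprS; lra.
exists ((u + v) / 2), v; split=> //; [exact: Sm|by rewrite ms|].
by rewrite exprS; lra.
Qed.

(** The exponents meeting both bounds contain 0 and 1 and are closed under midpoints. Bisection
    finds such exponents arbitrarily close to s, and continuity of the powers does the rest. *)
Lemma dist_powR_le A Z1 Z2 (x y s : R) : posdef A -> posdef Z1 -> posdef Z2 ->
  d Z1 1%:M <= x -> d 1%:M Z2 <= y -> d Z1 A <= x -> d A Z2 <= y -> 0 <= s <= 1 ->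
  d Z1 (mxpowR A s) <= x /\ d (mxpowR A s) Z2 <= y.
Proof.
move=> pA pZ1 pZ2 x0 y0 x1 y1 s01; have pp r := mxpowR_posdef r pA.
have half_le (a b z : R) : a <= z -> b <= z -> 2^-1 * (a + b) <= z.
  by move: a b z; clear => a b z; lra.
pose S r := d Z1 (mxpowR A r) <= x /\ d (mxpowR A r) Z2 <= y.
have S0 : S 0 by rewrite /S (mxpowR0 pA).
have S1 : S 1 by rewrite /S (mxpowR1 pA).
have Sm u v : S u -> S v -> S ((u + v) / 2).
  move=> [u1 u2] [v1 v2]; split.
    exact: le_trans (dist_midpoint_r u v pA pZ1) (half_le _ _ _ u1 v1).
  exact: le_trans (dist_midpoint_l u v pA pZ2) (half_le _ _ _ u2 v2).
have : forall e, 0 < e -> d Z1 (mxpowR A s) <= x + e /\ d (mxpowR A s) Z2 <= y + e.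
  move=> e e0; have [delta delta0 h] := dist_powR_continuous pA e0.
  have [k kd] : exists k, (2^-1 : R) ^+ k < delta.
    have : (2^-1 : R) ^+ k @[k --> \oo] --> (0 : R).
      by apply: cvg_expr; rewrite ger0_norm ?invr_ge0// invf_lt1// ltr1n.
    move=> /(cvgr_lt _) /(_ _ delta0) [k _ hk]; exists k; exact: (hk k (leqnn k)).
  have [u [v [[u1 u2] _ /andP[us sv] uv]]] := bisection k S0 S1 Sm s01.
  have su : `|s - u| < delta.
    rewrite ger0_norm ?subr_ge0//; apply: le_lt_trans kd; apply: le_trans uv.
    by rewrite lerD2r.
  split.
    apply: le_trans (dist_triangle pZ1 (pp u) (pp s)) _.
    by apply: lerD => //; exact: h.
  apply: le_trans (dist_triangle (pp s) (pp u) pZ2) _; rewrite addrC.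
  by apply: lerD => //; apply: h; rewrite distrC.
move=> h; split; apply/ler_addgt0Pr => e /h[]//.
Qed.

End Distance.

Theorem proposition5p7 (R : realType) (n : nat) (N : 'M[R[i]]_n -> R)
    (P : 'M[R[i]]_n) (t : R) :
  unitarily_invariant_norm N -> posdef P -> 0 < t < 1 ->
  geodesically_convex (midset N t 1%:M P).
Proof.
move=> hN pP t01; split=> [W []//|W0 W1 [pW0 a0 b0] [pW1 a1 b1] s].
rewrite in_itv /= => s01; have p1 := @posdef1 R n.
(* Congruence by Y = W0^(-1/2) sends W0 to 1, W1 to A and the geodesic point to A^s. The fixed
   endpoints 1 and P become the Z1 and Z2 of [dist_powR_le]. *)
pose Y := mxpowR W0 (- 2^-1); pose X := mxpowR W0 2^-1.
pose A := Y *m W1 *m Y; set G := geodesic W0 W1 s.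
have GE : G = X *m mxpowR A s *m X by reflexivity.
have uX : X \in unitmx by exact: mxpowR_unit.
have uY : Y \in unitmx by exact: mxpowR_unit.
have Xadj : X^t* = X by exact: mxpowR_adj.
have Yadj : Y^t* = Y by exact: mxpowR_adj.
have XY : X *m Y = 1%:M by rewrite (mxpowRD _ _ pW0) subrr (mxpowR0 pW0).
have YX : Y *m X = 1%:M by exact: mulmx1C.
have YW0 : Y *m W0 *m Y^t* = 1%:M by exact: mxpowR_whiten.
have YW1 : Y *m W1 *m Y^t* = A := f_equal (fun Z => Y *m W1 *m Z) Yadj.
have pA : posdef A by rewrite -YW1; exact: posdef_conj.
clearbody G A Y X.
have pG : posdef G.
  by rewrite GE -{2}Xadj; apply: posdef_conj; [exact: uX|exact: mxpowR_posdef].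
have YG : Y *m G *m Y^t* = mxpowR A s.
  by rewrite GE Yadj !mulmxA YX mul1mx -mulmxA XY mulmx1.
have pY Z : posdef Z -> posdef (Y *m Z *m Y^t*) by exact: posdef_conj.
have dY Z Z' : posdef Z -> posdef Z' ->
    dist N (Y *m Z *m Y^t*) (Y *m Z' *m Y^t*) = dist N Z Z'.
  by move=> pZ pZ'; exact: (dist_conj hN uY pZ pZ').
have [h1 h2] : dist N 1%:M G <= t * dist N 1%:M P /\
    dist N G P <= (1 - t) * dist N 1%:M P.
  rewrite -(dY _ _ p1 pG) -(dY _ _ pG pP) YG.
  apply: (dist_powR_le hN pA (pY _ p1) (pY _ pP) _ _ _ _ s01).
  - by have := dY _ _ p1 pW0; rewrite YW0 => ->; rewrite a0.
  - by have := dY _ _ pW0 pP; rewrite YW0 => ->; rewrite b0.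
  - by have := dY _ _ p1 pW1; rewrite YW1 => ->; rewrite a1.
  - by have := dY _ _ pW1 pP; rewrite YW1 => ->; rewrite b1.
suff [e1 e2] : dist N 1%:M G = t * dist N 1%:M P /\
    dist N G P = (1 - t) * dist N 1%:M P by [].
have := dist_triangle hN p1 pG pP.
move: h1 h2; move: (dist N 1%:M G) (dist N G P) (dist N 1%:M P) => x y z.
by clear=> h1 h2 h3; lra.
Qed.
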